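(* Let $n\in\mathbb N$, let $A$ be an $n\times n$ complex matrix all of whose eigenvalues have positive real parts, and let $G:\mathbb C^n\to\mathbb C^n$, $G\sim\sum_{m\ge2}G_m$, $G_m(x)=\mathcal G_m(x,\dots,x)$, be as in the context. Let $f:(0,\infty)\to\mathbb C^n$ be a function that is continuous on $[T_f,\infty)$ for some $T_f\ge 0$. Let $m_*\in\mathbb N$, let $(\mu_k)_{k=1}^\infty$ be a divergent, strictly increasing sequence of positive numbers such that the set $\mathcal S=\{\mu_k:k\in\mathbb N\}$ satisfies $x+y\in\mathcal S$ for all $x,y\in\mathcal S$, and let $(n_k)_{k=1}^\infty$ be an increasing sequence in $\mathbb N\cap[m_*,\infty)$ (meaning $n_k\le n_{k+1}$). Assume that $f$ admits the asymptotic expansion, in the $L_{m_*}$-sense of the context, $$f(t)\sim\sum_{k=1}^\infty f_k(t),\qquad f_k\in\mathscr F_{m_*}(n_k,-\mu_k,\mathbb C^n)\text{ for }k\in\mathbb N.$$ Let $T_0\ge 0$ and let $y\in C^1((T_0,\infty),\mathbb C^n)$ be a solution of $y'=-Ay+G(y)+f(t)$ on $(T_0,\infty)$ with $y(t)\to0$ as $t\to\infty$. Then there exist functions $y_k\in\mathscr F_{m_*}(n_k,-\mu_k,\mathbb C^n)$, $k\in\mathbb N$, such that $y$ admits the asymptotic expansion, in the same $L_{m_*}$-sense, $$y(t)\sim\sum_{k=1}^\infty y_k(t).$$ More specifically, suppose that $f_k(t)=p_k(\widehat{\mathcal L}_{n_k}(t))$ with $p_k\in\mathscr P_{m_*}(n_k,-\mu_k,\mathbb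 C^n)$ for all $k\in\mathbb N$. Then the functions $y_k$ can be constructed recursively as follows: for each $k\in\mathbb N$, $y_k(t)=q_k(\widehat{\mathcal L}_{n_k}(t))$, where $$q_k=\mathcal Z_A\Big(\sum_{m\ge2}\ \sum_{\mu_{j_1}+\mu_{j_2}+\cdots+\mu_{j_m}=\mu_k}\mathcal G_m(q_{j_1},q_{j_2},\ldots,q_{j_m})+p_k\Big).$$
   Context: $\mathbb N=\{1,2,\dots\}$, $\mathbb Z_+=\mathbb N\cup\{0\}$; $|\cdot|$ is the Euclidean norm; $u(t)=\mathcal O(h(t))$ means that there are $T,C>0$ with $|u(t)|\le Ch(t)$ for all $t\ge T$. Assumption on $G$: $G:\mathbb C^n\to\mathbb C^n$ is locally Lipschitz, and there exist functions $G_m:\mathbb C^n\to\mathbb C^n$, $m\ge 2$, each a homogeneous polynomial of degree $m$, such that for any $N\ge2$ there exists $\delta>0$ with $|G(x)-\sum_{m=2}^N G_m(x)|=\mathcal O(|x|^{N+\delta})$ as $x\to0$. For each $m\ge2$, $\mathcal G_m$ is an $m$-linear mapping (over $\mathbb C$) from $(\mathbb C^n)^m$ to $\mathbb C^n$ with $G_m(x)=\mathcal G_m(x,x,\ldots,x)$. Iterated functions: $E_0(t)=t$, $E_{m+1}(t)=e^{E_m(t)}$; $L_{-1}(t)=e^t$, $L_0(t)=t$, $L_{m+1}(t)=\ln L_m(t)$ for $m\in\mathbb Z_+$, $t>E_m(0)$. For $k\in\mathbb Z_+$, $\widehat{\mathcal L}_k(t)=(L_{-1}(t),L_0(t),L_1(t),\ldots,L_k(t))=(e^t,t,\ln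 t,\ldots,L_k(t))$, which lies in $(0,\infty)^{k+2}$ for $t>E_k(0)$. Power functions: for $t>0$, $c\in\mathbb C$, $t^c=\exp(c\ln t)$. For $z=(z_{-1},z_0,\ldots,z_k)\in(0,\infty)^{k+2}$ and $\alpha=(\alpha_{-1},\alpha_0,\ldots,\alpha_k)\in\mathbb C^{k+2}$, $z^\alpha=\prod_{j=-1}^kz_j^{\alpha_j}$. Classes: for integers $k\ge m\ge-1$ and $\mu\in\mathbb R$, $\mathcal E(m,k,\mu)$ is the set of $\alpha\in\mathbb C^{k+2}$ with $\operatorname{Re}\alpha_j=0$ for $-1\le j<m$ and $\operatorname{Re}\alpha_m=\mu$. For a complex linear space $X$, $\mathscr P_m(k,\mu,X)$ is the set of functions $p(z)=\sum_{\alpha\in S}z^\alpha\xi_\alpha$, $z\in(0,\infty)^{k+2}$, with $S$ a finite subset of $\mathcal E(m,k,\mu)$ and $\xi_\alpha\in X$; and $\mathscr F_m(k,\mu,X)=\{p\circ\widehat{\mathcal L}_k:p\in\mathscr P_m(k,\mu,X)\}$ (functions on $(E_k(0),\infty)$). For $k<k'$, such a function of $z\in(0,\infty)^{k+2}$ is regarded as a function of $z\in(0,\infty)^{k'+2}$ not depending on the extra variables (zero exponents). Operator $\mathcal Z_A$: for $p(z)=\sum_{\alpha\in S}z^\alpha\xi_\alpha\in\mathscr P_{-1}(k,0,\mathbb C^n)$, $(\mathcal Z_Ap)(z)=\sum_{\alpha\in S}z^\alpha(A+\alpha_{-1}I_n)^{-1}\xi_\alpha$ (here $\operatorname{Re}\alpha_{-1}=0$,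 so the inverses exist). One has $\mathscr P_m(k,\mu,\mathbb C^n)\subset\mathscr P_{-1}(k,0,\mathbb C^n)$ for $m\ge0$, so $\mathcal Z_A$ is defined there. Asymptotic expansion ($L_{m_*}$-sense): for $g$ from $(T,\infty)$ to a complex normed space $X$, a divergent, strictly increasing sequence $(\gamma_k)$ of positive numbers and $n_k\in\mathbb N\cap[m_*,\infty)$, $g(t)\sim\sum_{k=1}^\infty g_k(t)$ with $g_k\in\mathscr F_{m_*}(n_k,-\gamma_k,X)$ means: for each $N\in\mathbb N$ there is $\mu>\gamma_N$ with $\|g(t)-\sum_{k=1}^Ng_k(t)\|_X=\mathcal O(L_{m_*}(t)^{-\mu})$. In the double sum, $m$ ranges over integers $\ge2$ and $j_1,\ldots,j_m$ over $\mathbb N$ subject to the stated condition; the sum is finite, involves only indices $j_\ell\le k-1$, and is zero if no such indices exist. *)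

(* Defs.v *)
(* The reals are an arbitrary [R : realType] and the complex numbers are
   [R[i]]; C^n is the space of column vectors ['cV[R[i]]_n].

   Index conventions.  Sequences indexed by {1, 2, ...} are functions on [nat]
   shifted by one.  The components z_{-1}, z_0, ..., z_k of a (k+2)-tuple are
   the entries of a row vector, z_j being entry j + 1. *)
From HB Require Import structures.
From mathcomp Require Import all_boot all_order all_algebra complex.
From mathcomp Require Import ring.
From mathcomp Require Import all_classical all_reals all_analysis.
Set Implicit Arguments.
Unset Strict Implicit.
Unset Printing Implicit Defensive.
Import Order.TTheory GRing.Theory Num.Theory.
Import numFieldNormedType.Exports.
Local Open Scope classical_set_scope.
Local Open Scope ring_scope.
Local Open Scope complex_scope.

Section ComplexSpace.
Variables (R : realType) (n : nat).
Local Notation V := 'cV[R[i]]_n.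

Definition enorm (x : V) : R :=
  Num.sqrt (\sum_(i < n) (complex.Re (x i 0) ^+ 2 + complex.Im (x i 0) ^+ 2)).

Definition bigO_infty (u : R -> V) (h : R -> R) : Prop :=
  exists T C : R, [/\ 0 < T, 0 < C & forall t, T <= t -> enorm (u t) <= C * h t].

Definition bigO_zero (u : V -> V) (h : V -> R) : Prop :=
  exists r C : R, [/\ 0 < r, 0 < C & forall x, enorm x < r -> enorm (u x) <= C * h x].

Definition locally_lipschitz (G : V -> V) : Prop :=
  forall x : V, exists r L : R, 0 < r /\
    forall u v : V, enorm (u - x) < r -> enorm (v - x) < r ->
      enorm (G u - G v) <= L * enorm (u - v).

(* [c a] is the coefficient of the monomial x^a; the exponents of a monomial of
   degree m are at most m. *)
Definition homogeneous_polynomial (m : nat) (P : V -> V) : Prop :=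
  exists c : {ffun 'I_n -> 'I_m.+1} -> V, forall x : V,
    P x = \sum_(a : {ffun 'I_n -> 'I_m.+1} | (\sum_(i < n) a i)%N == m)
            (\prod_(i < n) x i 0 ^+ a i) *: c a.

Definition multilinear_map (m : nat) (g : ('I_m -> V) -> V) : Prop :=
  forall (i : 'I_m) (x : 'I_m -> V) (c : R[i]) (u v : V),
    g (fun j => if j == i then c *: u + v else x j) =
    c *: g (fun j => if j == i then u else x j) +
    g (fun j => if j == i then v else x j).

(* Neither a topology nor a real normed-space structure is available on [R[i]],
   so continuity and differentiation are those of the real and imaginary parts
   of the components. *)
Definition continuous_within (D : set R) (u : R -> V) : Prop :=
  forall i : 'I_n, {within D, continuous (fun t => complex.Re (u t i 0))} /\
                   {within D, continuous (fun t => complex.Im (u t i 0))}.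

Definition has_derivative (u : R -> V) (t : R) (v : V) : Prop :=
  forall i : 'I_n,
    is_derive t 1 (fun s => complex.Re (u s i 0)) (complex.Re (v i 0)) /\
    is_derive t 1 (fun s => complex.Im (u s i 0)) (complex.Im (v i 0)).

Definition C1_above (T : R) (u : R -> V) : Prop :=
  exists du : R -> V, (forall t, T < t -> has_derivative u t (du t)) /\
                      continuous_within [set t | T < t] du.

(* G ~ \sum_{m >= 2} G_m at the origin, together with the m-linear maps
   representing the G_m.  The values at m = 0, 1 are irrelevant. *)
Definition admissible_nonlinearity (G : V -> V) (Gm : nat -> V -> V)
    (GG : forall m : nat, ('I_m -> V) -> V) : Prop :=
  [/\ locally_lipschitz G,
      forall m, (2 <= m)%N -> homogeneous_polynomial m (Gm m),
      forall N, (2 <= N)%N -> exists2 delta : R, 0 < delta &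
        bigO_zero (fun x => G x - \sum_(2 <= m < N.+1) Gm m x)
                  (fun x => enorm x `^ (N%:R + delta)) &
      forall m, (2 <= m)%N ->
        multilinear_map (GG m) /\ forall x : V, Gm m x = GG m (fun=> x)].

End ComplexSpace.

Section PowerFunctions.
Variable R : realType.

Definition cexp (c : R[i]) : R[i] :=
  (expR (complex.Re c))%:C * (cos (complex.Im c) +i* sin (complex.Im c)).

Definition cpow (t : R) (c : R[i]) : R[i] := cexp (c * (ln t)%:C).

Definition Eiter (m : nat) (t : R) : R := iter m expR t.

Definition Liter (m : nat) (t : R) : R := iter m (@ln R) t.

Definition Lhat (k : nat) (t : R) : 'rV[R]_k.+2 :=
  \row_(j < k.+2) (if j == 0 :> nat then expR t else Liter j.-1 t).

Definition positive_vec (k : nat) (z : 'rV[R]_k) : Prop := forall j, 0 < z 0 j.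

Definition vpow (k : nat) (z : 'rV[R]_k) (a : 'rV[R[i]]_k) : R[i] :=
  \prod_(j < k) cpow (z 0 j) (a 0 j).

Definition expclass (m : int) (k : nat) (mu : R) : set 'rV[R[i]]_k.+2 :=
  [set a : 'rV[R[i]]_k.+2 | forall j : 'I_k.+2,
     (j%:Z - 1 < m -> complex.Re (a 0 j) = 0) /\
     (j%:Z - 1 = m -> complex.Re (a 0 j) = mu)].

Definition power_sum (X : lmodType R[i]) (k : nat) (S : seq 'rV[R[i]]_k)
    (xi : 'rV[R[i]]_k -> X) (z : 'rV[R]_k) : X :=
  \sum_(a <- S) vpow z a *: xi a.

Definition represents (X : lmodType R[i]) (m : int) (k : nat) (mu : R)
    (S : seq 'rV[R[i]]_k.+2) (xi : 'rV[R[i]]_k.+2 -> X)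
    (p : 'rV[R]_k.+2 -> X) : Prop :=
  [/\ uniq S, {in S, forall a, expclass m mu a} &
      forall z, positive_vec z -> p z = power_sum S xi z].

(* The values of a member of P_m(k, mu, X) outside (0, oo)^(k+2), and of a member
   of F_m(k, mu, X) outside (E_k(0), oo), are unconstrained. *)
Definition classP (X : lmodType R[i]) (m : int) (k : nat) (mu : R) :
    set ('rV[R]_k.+2 -> X) :=
  [set p | exists S xi, represents m mu S xi p].

Definition classF (X : lmodType R[i]) (m : int) (k : nat) (mu : R) :
    set (R -> X) :=
  [set g | exists2 p, classP m mu p &
     forall t, Eiter k 0 < t -> g t = p (Lhat k t)].

(* A function of (z_{-1}, ..., z_k) is seen as a function of
   (z_{-1}, ..., z_k'), k <= k', by precomposition with [restrict_vars]. *)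
Definition restrict_vars (k k' : nat) (z : 'rV[R]_k'.+2) : 'rV[R]_k.+2 :=
  \row_(j < k.+2) z 0 (inord j).

(* Z_A p is read off any representation of p in P_{-1}(k, 0, C^n); it does not
   depend on the representation picked by [xget], see [opZE]. *)
Definition opZ (n : nat) (A : 'M[R[i]]_n) (k : nat)
    (p : 'rV[R]_k.+2 -> 'cV[R[i]]_n) (z : 'rV[R]_k.+2) : 'cV[R[i]]_n :=
  let r := xget ([::], fun=> 0)
             [set r | represents (-1) 0 r.1 r.2 p] in
  power_sum r.1 (fun a => invmx (A + (a 0 0)%:M) *m r.2 a) z.

Definition asymptotic_expansion (n ms : nat) (gamma : nat -> R)
    (nk : nat -> nat) (g : R -> 'cV[R[i]]_n) (gk : nat -> R -> 'cV[R[i]]_n) : Prop :=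
  (forall k, classF ms (nk k) (- gamma k) (gk k)) /\
  (forall N, exists2 mu : R, gamma N < mu &
     bigO_infty (fun t => g t - \sum_(k < N.+1) gk k t)
                (fun t => Liter ms t `^ (- mu))).

(* \sum_(m >= 2) \sum_(mu_{j_1} + ... + mu_{j_m} = mu_k) GG_m(q_{j_1}, ..., q_{j_m})
   as a function on (0, oo)^(n_k+2).  Both sums have finite support when mu is
   positive, strictly increasing and divergent. *)
Definition nonlinear_sum (n : nat) (GG : forall m, ('I_m -> 'cV[R[i]]_n) -> 'cV[R[i]]_n)
    (mu : nat -> R) (nk : nat -> nat)
    (q : forall k, 'rV[R]_(nk k).+2 -> 'cV[R[i]]_n) (k : nat)
    (z : 'rV[R]_(nk k).+2) : 'cV[R[i]]_n :=
  \sum_(m \in [set m | (2 <= m)%N])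
    \sum_(j \in [set j : {ffun 'I_m -> nat} | \sum_(l < m) mu (j l) = mu k])
      GG m (fun l => q (j l) (restrict_vars (nk (j l)) z)).

End PowerFunctions.

Section OpZWellDefined.
Variable R : realType.
Implicit Types (c d : R[i]) (s t : R).

Lemma cexpD c d : cexp (c + d) = cexp c * cexp d.
Proof.
case: c => a b; case: d => a' b'; rewrite /cexp /= expRD cosD sinD.
apply/eqP; rewrite eq_complex /= !mul0r !subr0 !addr0.
by apply/andP; split; apply/eqP; ring.
Qed.

Lemma cexp0 : cexp (0 : R[i]) = 1.
Proof. by rewrite /cexp /= expR0 cos0 sin0 mul1r. Qed.

Lemma cexp_neq0 c : cexp c != 0.
Proof.
apply/negP => /eqP c0; have := cexpD c (- c).
by rewrite subrr cexp0 c0 mul0r => /eqP; rewrite oner_eq0.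
Qed.

Lemma Re_cexp_inj c d : cexp c = cexp d -> complex.Re c = complex.Re d.
Proof.
have E (e : R[i]) : complex.Re (cexp e) ^+ 2 + complex.Im (cexp e) ^+ 2 =
           expR (complex.Re e) ^+ 2.
  rewrite /cexp /= !mul0r subr0 addr0 !exprMn -mulrDr cos2Dsin2.
  by rewrite mulr1.
move=> cd; have := E c; rewrite cd E => /eqP.
rewrite eqrXn2 ?expR_ge0// => /eqP e; symmetry; exact: expR_inj.
Qed.

Lemma cpow_neq0 t c : cpow t c != 0. Proof. exact: cexp_neq0. Qed.

Lemma cpow1 c : cpow 1 c = 1.
Proof. by rewrite /cpow ln1 mulr0 cexp0. Qed.

Lemma cpowM s t c : 0 < s -> 0 < t -> cpow (s * t) c = cpow s c * cpow t c.
Proof.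
by move=> s0 t0; rewrite /cpow lnM ?posrE// rmorphD /= mulrDr cexpD.
Qed.

Lemma cpow_separates c d : c != d -> exists2 t, 0 < t & cpow t c != cpow t d.
Proof.
move=> cd; have [re|re] := eqVneq (complex.Re c) (complex.Re d); last first.
  exists (expR 1); first exact: expR_gt0.
  rewrite /cpow expRK !mulr1; apply: contra_neq re; exact: Re_cexp_inj.
have im : complex.Im c - complex.Im d != 0.
  rewrite subr_eq0; apply: contra_neq cd => im.
  by apply/eqP; rewrite eq_complex re im !eqxx.
pose r := pi / (complex.Im c - complex.Im d).
exists (expR r); first exact: expR_gt0.
rewrite /cpow expRK.
have -> : c * r%:C = d * r%:C + (0 +i* pi).
  have rE : r * (complex.Im c - complex.Im d) = pi by rewrite divfK.
  move: (r) rE => {}r rE; apply/eqP; rewrite eq_complex.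
  case: c d re {cd im} rE => [a b] [a' b'] /= -> rE.
  by rewrite !mulr0 !subr0 !add0r addr0 eqxx /= -rE; apply/eqP; ring.
rewrite cexpD.
have -> : cexp (0 +i* (pi : R)) = -1.
  rewrite /cexp /= expR0 cospi sinpi mul1r.
  by apply/eqP; rewrite eq_complex /= oppr0 !eqxx.
rewrite mulrN1 eq_sym -subr_eq0 opprK -mulr2n mulrn_eq0 /=.
exact: cexp_neq0.
Qed.

Lemma vpow_neq0 k (z : 'rV[R]_k) a : vpow z a != 0.
Proof. by apply/prodf_neq0 => j _; exact: cpow_neq0. Qed.

Lemma vpow_separates k (a b : 'rV[R[i]]_k) :
  a != b -> exists2 w, positive_vec w & vpow w a != vpow w b.
Proof.
move=> ab; have [j abj] : exists j, a 0 j != b 0 j.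
  apply/existsP; apply: contra_neqT ab => /existsPn H.
  by apply/rowP => j; apply/eqP; have := H j; rewrite negbK.
have [t t0 tab] := cpow_separates abj.
exists (\row_l (if l == j then t else 1)).
  by move=> l; rewrite mxE; case: ifP.
have E (e : 'rV[R[i]]_k) :
    vpow (\row_l (if l == j then t else 1)) e = cpow t (e 0 j).
  rewrite /vpow (bigD1 j)//= mxE eqxx big1 ?mulr1// => l lj.
  by rewrite mxE (negbTE lj) cpow1.
by rewrite !E.
Qed.

Lemma vpowM k (z w : 'rV[R]_k) a : positive_vec z -> positive_vec w ->
  vpow (\row_j (z 0 j * w 0 j)) a = vpow z a * vpow w a.
Proof.
move=> z0 w0; rewrite /vpow -big_split /=.
by apply: eq_bigr => j _; rewrite mxE cpowM.
Qed.

Lemma power_sum_eq0 (X : lmodType R[i]) k (S : seq 'rV[R[i]]_k) (xi : _ -> X) :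
  uniq S -> (forall z, positive_vec z -> power_sum S xi z = 0) ->
  {in S, forall a, xi a = 0}.
Proof.
elim: S xi => // b S IH xi /= /andP[bS uS] H.
have HS : {in S, forall a, xi a = 0}.
  move=> a aS; have ab : a != b by apply: contraNneq bS => <-.
  have [w w0 wab] := vpow_separates ab.
  have H' z : positive_vec z ->
      power_sum S (fun a => (vpow w a - vpow w b) *: xi a) z = 0.
    move=> z0; have zw0 : positive_vec (\row_j (z 0 j * w 0 j)).
      by move=> j; rewrite mxE mulr_gt0.
    have := H _ zw0; rewrite /power_sum big_cons => e1.
    have := H _ z0; rewrite /power_sum big_cons => e2.
    transitivity ((vpow (\row_j (z 0 j * w 0 j)) b *: xi b +
        \sum_(j <- S) vpow (\row_j0 (z 0 j0 * w 0 j0)) j *: xi j) -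
      vpow w b *: (vpow z b *: xi b + \sum_(j <- S) vpow z j *: xi j));
      last by rewrite e1 e2 scaler0 subr0.
    rewrite scalerDr scaler_sumr opprD addrACA vpowM// scalerA mulrC subrr add0r.
    rewrite -sumrB; apply: eq_bigr => l _.
    by rewrite vpowM// !scalerA -scalerBl mulrBr (mulrC (vpow w b)).
  have /eqP := IH _ uS H' a aS; rewrite scaler_eq0 subr_eq0 (negbTE wab) /=.
  by move=> /eqP.
move=> a; rewrite inE => /orP[/eqP ->|]; last exact: HS.
have one0 : positive_vec (\row_(_ < k) (1 : R)) by move=> j; rewrite mxE.
have := H _ one0; rewrite /power_sum big_cons big1_seq ?addr0; last first.
  by move=> l /= lS; rewrite HS// scaler0.
by move=> /eqP; rewrite scaler_eq0 (negbTE (vpow_neq0 _ _)) /= => /eqP.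
Qed.

Lemma power_sum_widen (X : lmodType R[i]) k (S U : seq 'rV[R[i]]_k)
    (xi : _ -> X) (z : 'rV[R]_k) :
  uniq S -> uniq U -> {subset S <= U} ->
  power_sum S xi z = power_sum U (fun a => if a \in S then xi a else 0) z.
Proof.
move=> uS uU SU; rewrite /power_sum.
under [RHS]eq_bigr => a _ do rewrite -(mulr1n (vpow z a)) fun_if scaler0.
rewrite -big_mkcond -big_filter; apply: perm_big.
apply: uniq_perm => //; first exact: filter_uniq.
by move=> a; rewrite mem_filter; case: (boolP (a \in S)) => //= /SU ->.
Qed.

Lemma opZE n (A : 'M[R[i]]_n) k (p : 'rV[R]_k.+2 -> 'cV[R[i]]_n) S xi :
  represents (-1) 0 S xi p ->
  opZ A p = power_sum S (fun a => invmx (A + (a 0 0)%:M) *m xi a).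
Proof.
move=> rep; apply/funext => z; rewrite /opZ.
set P := [set r | _]; have : P (xget ([::], fun=> 0) P).
  by apply: (@xgetPex _ _ P); exists (S, xi).
case: (xget _ _) => S' xi' [/= uS' _ H']; case: rep => uS _ H.
set U := undup (S ++ S').
have uU : uniq U by exact: undup_uniq.
have SU : {subset S <= U} by move=> a aS; rewrite mem_undup mem_cat aS.
have S'U : {subset S' <= U}.
  by move=> a aS; rewrite mem_undup mem_cat aS orbT.
rewrite (power_sum_widen _ _ uS uU)// (power_sum_widen _ _ uS' uU)//.
apply: eq_big_seq => a aU; congr (_ *: _).
have : (if a \in S' then xi' a else 0) - (if a \in S then xi a else 0) = 0.
  apply: (@power_sum_eq0 _ _ U (fun a => (if a \in S' then xi' a else 0) -
    (if a \in S then xi a else 0))) => // y y0.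
  rewrite /power_sum; under eq_bigr do rewrite scalerBr.
  rewrite sumrB; apply/eqP; rewrite subr_eq0; apply/eqP.
  rewrite -[LHS]/(power_sum _ _ _) -[RHS]/(power_sum _ _ _).
  by rewrite -!power_sum_widen// -H// -H'.
move=> /eqP; rewrite subr_eq0 => /eqP.
case: (a \in S'); case: (a \in S) => // e;
  by [rewrite e | rewrite e mulmx0 | rewrite -e mulmx0].
Qed.

End OpZWellDefined.

(* Main.v *)
(* Write [ell = ln L_{m_*}], so that [L_{m_*}(t)^(-s) = exp (- s ell(t))].

   Linear estimate.  By Schur triangularisation and a diagonal rescaling, [A] is
   coercive for some Euclidean norm [|Q x|].  If [v' = - A v + g], then
   [phi = |Q v|^2] satisfies [phi' <= - a phi + C |g|^2]; as [ell' --> 0], multiples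
   of [exp (- 2 s ell)] are supersolutions, so [v] decays as fast as [g], and a
   term of [g] that is small compared with [v] is harmless.  Applied to [y] itself,
   this gives [y = O(L_{m_*}^(-s))] for all [s < mu_1].

   Expansion.  Differentiating a power of the iterated logarithms multiplies it by
   [alpha_{-1}], up to a factor [O(1/t)], which is smaller than any power of
   [L_{m_*}].  Hence [y_k = q_k o Lhat] solves [y_k' = - A y_k + N_k + f_k] up to a
   negligible term, where [N_k] is the nonlinear sum.  Let [r] be the remainder
   after the terms [k < N].  Expanding the multilinear maps at
   [y = \sum_(k < N) y_k + r], the products of total order at most [mu_N] are
   exactly those collected in the [N_k], [k <= N]; all others have order greater than
   [mu_N], because [S] is closed under addition and the order of [r] exceeds
   [mu_N - mu_1].  The linear estimate then applies to the next remainder. *)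
Require Import Defs.
From HB Require Import structures.
From mathcomp Require Import all_boot all_order all_algebra complex.
From mathcomp Require Import ring lra.
From mathcomp Require Import all_classical all_reals all_analysis.
Set Implicit Arguments.
Unset Strict Implicit.
Unset Printing Implicit Defensive.
Import Order.TTheory GRing.Theory Num.Theory.
Import numFieldNormedType.Exports.
Local Open Scope classical_set_scope.
Local Open Scope ring_scope.
Local Open Scope complex_scope.

Import Normc.

(** * Modulus of complex numbers and of the complex exponential *)

Section Modulus.
Variable R : realType.
Implicit Types z w c : R[i].

Lemma normc_ge0 z : 0 <= normc z.
Proof. by case: z => a b /=; exact: sqrtr_ge0. Qed.

Lemma normc2E z : normc z ^+ 2 = complex.Re z ^+ 2 + complex.Im z ^+ 2.
Proof. by case: z => a b /=; rewrite sqr_sqrtr// addr_ge0 ?sqr_ge0. Qed.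

Lemma ler_normcD z w : normc (z + w) <= normc z + normc w.
Proof. exact: le_normcD. Qed.

Lemma ler_normc_sum (I : Type) (r : seq I) (P : pred I) (F : I -> R[i]) :
  normc (\sum_(i <- r | P i) F i) <= \sum_(i <- r | P i) normc (F i).
Proof.
elim/big_rec2 : _ => [|i y x _ le_xy]; first by rewrite normc0.
by rewrite (le_trans (ler_normcD _ _))// lerD2l.
Qed.

Lemma normc_prod (I : Type) (r : seq I) (P : pred I) (F : I -> R[i]) :
  normc (\prod_(i <- r | P i) F i) = \prod_(i <- r | P i) normc (F i).
Proof. exact: (big_morph (@normc R) (@normcM R) (normc1 R)). Qed.

Lemma normc_cexp c : normc (cexp c) = expR (complex.Re c).
Proof.
rewrite /cexp normcM /= cos2Dsin2 sqrtr1 mulr1 expr0n /= addr0 sqrtr_sqr.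
by rewrite ger0_norm ?expR_ge0.
Qed.

Lemma normc_real (a : R) : normc a%:C = `|a|.
Proof. by rewrite /= expr0n /= addr0 sqrtr_sqr. Qed.

End Modulus.

(** * Growth and derivatives of iterated logarithms *)

Section IteratedLogarithms.
Variable R : realType.
Implicit Types (t s sig : R) (i j : nat).

Lemma LiterS j t : Liter j.+1 t = ln (Liter j t). Proof. by []. Qed.

Lemma near_Liter_gt j (A : R) : \forall t \near +oo, A < Liter j t.
Proof.
elim: j A => [|j IH] A; first by apply: nbhs_pinfty_gt; exact: num_real.
near=> t; have h : expR A < Liter j t by near: t; exact: IH.
by rewrite LiterS -[A]expRK ltr_ln// ?posrE ?expR_gt0// (lt_trans _ h)// expR_gt0.
Unshelve. all: end_near. Qed.

Lemma near_Liter_gtn k (A : R) :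
  \forall t \near +oo, forall i, (i < k)%N -> A < Liter i t.
Proof.
elim: k => [|k IH]; first by near=> t.
near=> t => i; rewrite ltnS leq_eqVlt => /predU1P[->|].
  by near: t; exact: near_Liter_gt.
by move: i; near: t; exact: IH.
Unshelve. all: end_near. Qed.

Lemma ln_le_small (eps : R) : 0 < eps -> \forall x \near +oo, ln x <= eps * x.
Proof.
move=> e0; near=> x.
have x0 : 0 < x by near: x; apply: nbhs_pinfty_gt; exact: num_real.
(* The bound [ln (eps / 2 * x) < eps / 2 * x] costs the constant [- ln (eps / 2)], which the other
   half of [eps * x] absorbs for large [x]. *)
have e20 : 0 < eps / 2 by rewrite divr_gt0.
have := ln_sublinear (mulr_gt0 e20 x0).
rewrite lnM ?posrE// => h.
have : - ln (eps / 2) / (eps / 2) <= x by near: x; apply: nbhs_pinfty_ge; exact: num_real.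
by rewrite ler_pdivrMr// => h'; lra.
Unshelve. all: end_near. Qed.

Lemma Liter_cvgy j : Liter j t @[t --> +oo] --> (+oo : set_system R).
Proof.
apply/cvgryPgt => A; exact: near_Liter_gt.
Qed.

(** For consecutive iterates this is [ln_le_small] composed with [Liter_cvgy]; each further
    logarithm only decreases the left-hand side. *)
Lemma near_Liter_small i j (eps : R) : (i < j)%N -> 0 < eps ->
  \forall t \near +oo, Liter j t <= eps * Liter i t.
Proof.
move=> + e0; elim: j => // j IH; rewrite ltnS leq_eqVlt => /predU1P[->|ij].
  exact: (Liter_cvgy j (ln_le_small e0)).
near=> t; have h : Liter j t <= eps * Liter i t by near: t; exact: IH.
rewrite (le_trans _ h)// LiterS ltW// ln_sublinear//.
by near: t; exact: near_Liter_gt.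
Unshelve. all: end_near. Qed.

Definition dLiter j t : R := \prod_(i < j) (Liter i t)^-1.

Lemma is_derive_Liter j t : (forall i, (i < j)%N -> 0 < Liter i t) ->
  is_derive t 1 (Liter j) (dLiter j t).
Proof.
elim: j => [|j IH] h.
  by rewrite /dLiter big_ord0; exact: is_derive_id.
have d1 : is_derive t 1 (Liter j) (dLiter j t).
  by apply: IH => i ij; apply: h; rewrite ltnW.
have d2 := is_derive1_ln (h j (ltnSn j)).
have := is_derive1_comp d2 d1.
by rewrite /dLiter big_ord_recr /= mulrC.
Qed.

(** The factor of index 0 is 1/t and the others are at most 1 once all iterates exceed 1. The shift
    to [j.+1] excludes L_0, whose derivative is 1. *)
Lemma near_dLiter j : \forall t \near +oo, 0 <= dLiter j.+1 t <= t^-1.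
Proof.
near=> t.
have h i : (i < j.+1)%N -> 1 < Liter i t.
  by move: i; near: t; exact: near_Liter_gtn.
rewrite /dLiter big_ord_recl /=; set p := \prod_(_ < _) _.
have t1 : 1 < t := h 0 isT.
have t0 : 0 <= t^-1 by rewrite invr_ge0; lra.
have p0 : 0 <= p.
  apply: prodr_ge0 => i _; rewrite invr_ge0 ltW// (lt_trans ltr01)//.
  exact: (h (lift ord0 i)).
have p1 : p <= 1.
  apply: prodr_ile1 => i _; have h1 : 1 < Liter (lift ord0 i) t by exact: (h (lift ord0 i)).
  have h0 : 0 < Liter (lift ord0 i) t by lra.
  by rewrite invr_ge0 (ltW h0) /= invf_le1// ltW.
by rewrite mulr_ge0//= ler_piMr.
Unshelve. all: end_near. Qed.

End IteratedLogarithms.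

(* [ord m sig u]: [u] is [O(L_m(t)^(-s))] for every [s < sig].  Letting [s] vary
   makes constant factors disappear, since [L_m] tends to infinity; [Liter m.+1]
   is [ln L_m]. *)
Definition ord (R : realType) (m : nat) (sig : R) (u : R -> R[i]) : Prop :=
  forall s, s < sig ->
    \forall t \near +oo, normc (u t) <= expR (- s * Liter m.+1 t).

(** * Calculus of decay orders measured in powers of L_m *)

Section Order.
Variables (R : realType) (m : nat).
Implicit Types (t s sig : R) (u v : R -> R[i]).
Local Notation ell := (@Liter R m.+1).

(** Any constant is eventually below exp((s' - s) ell), so giving up a little of the exponent
    removes it. *)
Lemma near_absorb (s s' C : R) : s < s' ->
  \forall t \near +oo, C * expR (- s' * ell t) <= expR (- s * ell t).
Proof.
move=> ss'; near=> t.
have -> : - s * ell t = (s' - s) * ell t + - s' * ell t by ring.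
rewrite expRD ler_wpM2r ?expR_ge0//.
have C0 : 0 < `|C| + 1 by rewrite ltr_wpDl.
have : ln (`|C| + 1) / (s' - s) < ell t by near: t; exact: near_Liter_gt.
rewrite ltr_pdivrMr ?subr_gt0// mulrC -ltr_expR lnK ?posrE// => h.
by rewrite (le_trans _ (ltW h))// (le_trans (ler_norm _))// lerDl.
Unshelve. all: end_near. Qed.

Lemma ord_le sig sig' u : sig' <= sig -> ord m sig u -> ord m sig' u.
Proof. by move=> ss h s s'; apply: h; exact: lt_le_trans ss. Qed.

Lemma ord_near_eq sig u v :
  (\forall t \near +oo, u t = v t) -> ord m sig u -> ord m sig v.
Proof. by move=> uv h s ssig; near=> t; rewrite -(near uv t)//; near: t; exact: h.
Unshelve. all: end_near. Qed.

Lemma ord_zero sig : ord m sig (fun=> 0).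
Proof. by move=> s _; near=> t; rewrite normc0 expR_ge0. Unshelve. all: end_near. Qed.

Lemma ordD sig u v : ord m sig u -> ord m sig v -> ord m sig (fun t => u t + v t).
Proof.
move=> hu hv s ssig.
have [s1 s2] := midf_lt ssig; set s' := (s + sig) / 2 in s1 s2.
near=> t.
have h1 : normc (u t) <= expR (- s' * ell t) by near: t; exact: hu.
have h2 : normc (v t) <= expR (- s' * ell t) by near: t; exact: hv.
have h3 : 2 * expR (- s' * ell t) <= expR (- s * ell t).
  by near: t; exact: near_absorb.
by have := ler_normcD (u t) (v t); lra.
Unshelve. all: end_near. Qed.

(** Order 0 only asks for the bounds exp(- s ell) with s < 0, which tend to infinity. *)
Lemma ord_cst (c : R[i]) : ord m 0 (fun=> c).
Proof.
move=> s s0; near=> t.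
have : normc c * expR (- 0 * ell t) <= expR (- s * ell t).
  by near: t; exact: near_absorb.
by rewrite oppr0 mul0r expR0 mulr1.
Unshelve. all: end_near. Qed.

Lemma ordM sig1 sig2 u v : ord m sig1 u -> ord m sig2 v ->
  ord m (sig1 + sig2) (fun t => u t * v t).
Proof.
(* [d] splits the slack of [s] below [sig1 + sig2] equally between the two factors. *)
move=> hu hv s ssig; pose d := (sig1 + sig2 - s) / 2.
have d0 : 0 < d by rewrite divr_gt0// subr_gt0.
have h1 : sig1 - d < sig1 by lra.
have h2 : sig2 - d < sig2 by lra.
have -> : s = (sig1 - d) + (sig2 - d) by rewrite /d; lra.
near=> t; rewrite normcM opprD mulrDl expRD.
by apply: ler_pM; rewrite ?normc_ge0//; near: t; [exact: hu|exact: hv].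
Unshelve. all: end_near. Qed.

Lemma ordMl sig (c : R[i]) u : ord m sig u -> ord m sig (fun t => c * u t).
Proof. by move=> h; rewrite -[sig]add0r; apply: ordM => //; exact: ord_cst. Qed.

Lemma ordN sig u : ord m sig u -> ord m sig (fun t => - u t).
Proof. by move=> h s ss; near=> t; rewrite normcN; near: t; exact: h.
Unshelve. all: end_near. Qed.

Lemma ord_sum sig (I : Type) (r : seq I) (P : pred I) (F : I -> R -> R[i]) :
  (forall i, P i -> ord m sig (F i)) ->
  ord m sig (fun t => \sum_(i <- r | P i) F i t).
Proof.
move=> h; elim: r => [|i r IH].
  by under eq_fun do rewrite big_nil; exact: ord_zero.
under eq_fun do rewrite big_cons; case: (boolP (P i)) => // Pi.
by apply: ordD => //; exact: h.
Qed.

Lemma ord_prod (I : Type) (r : seq I) (sig : I -> R) (F : I -> R -> R[i]) :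
  (forall i, ord m (sig i) (F i)) ->
  ord m (\sum_(i <- r) sig i) (fun t => \prod_(i <- r) F i t).
Proof.
move=> h; elim: r => [|i r IH].
  rewrite big_nil; under eq_fun do rewrite big_nil.
  exact: ord_cst.
rewrite (_ : (fun t => _) = fun t => F i t * \prod_(i <- r) F i t).
  by rewrite big_cons; exact: ordM.
by apply/funext => t; rewrite big_cons.
Qed.

End Order.

(** * Differentiation of complex-valued functions of a real variable *)

Section Derivatives.
Variable R : realType.
Implicit Types (t : R) (u v : R -> R[i]).

Definition cderiv u t (d : R[i]) : Prop :=
  is_derive t 1 (fun s => complex.Re (u s)) (complex.Re d) /\
  is_derive t 1 (fun s => complex.Im (u s)) (complex.Im d).

Lemma cderiv_cst (c : R[i]) t : cderiv (fun=> c) t 0.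
Proof. by split; exact: is_derive_cst. Qed.

Lemma cderivD u v t d e : cderiv u t d -> cderiv v t e ->
  cderiv (fun s => u s + v s) t (d + e).
Proof.
move=> [u1 u2] [v1 v2]; split.
- have -> : complex.Re (d + e) = complex.Re d + complex.Re e
    by case: d e {u1 u2 v1 v2} => [? ?] [? ?].
  rewrite (_ : (fun s => _) = (fun s => complex.Re (u s)) + (fun s => complex.Re (v s))).
    exact: is_deriveD.
  by apply/funext => s; rewrite fctE; case: (u s) (v s) => [? ?] [? ?].
- have -> : complex.Im (d + e) = complex.Im d + complex.Im e
    by case: d e {u1 u2 v1 v2} => [? ?] [? ?].
  rewrite (_ : (fun s => _) = (fun s => complex.Im (u s)) + (fun s => complex.Im (v s))).
    exact: is_deriveD.
  by apply/funext => s; rewrite fctE; case: (u s) (v s) => [? ?] [? ?].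
Qed.

Lemma cderivM u v t d e : cderiv u t d -> cderiv v t e ->
  cderiv (fun s => u s * v s) t (d * v t + u t * e).
Proof.
move=> [u1 u2] [v1 v2]; split.
- rewrite (_ : (fun s => _) = (fun s => complex.Re (u s)) * (fun s => complex.Re (v s)) -
    (fun s => complex.Im (u s)) * (fun s => complex.Im (v s))); last first.
    by apply/funext => s; rewrite !fctE; case: (u s) (v s) => [? ?] [? ?].
  apply: is_derive_eq; rewrite /= /GRing.scale /=.
  by case: d e (u t) (v t) {u1 u2 v1 v2} => [? ?] [? ?] [? ?] [? ?] /=; ring.
- rewrite (_ : (fun s => _) = (fun s => complex.Re (u s)) * (fun s => complex.Im (v s)) +
    (fun s => complex.Im (u s)) * (fun s => complex.Re (v s))); last first.
    by apply/funext => s; rewrite !fctE; case: (u s) (v s) => [? ?] [? ?].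
  apply: is_derive_eq; rewrite /= /GRing.scale /=.
  by case: d e (u t) (v t) {u1 u2 v1 v2} => [? ?] [? ?] [? ?] [? ?] /=; ring.
Qed.

Lemma cderivMl (c : R[i]) u t d : cderiv u t d -> cderiv (fun s => c * u s) t (c * d).
Proof.
by move=> h; have := cderivM (cderiv_cst c t) h; rewrite mul0r add0r.
Qed.

Lemma cderiv_sum (I : Type) (r : seq I) (P : pred I) (F : I -> R -> R[i]) (d : I -> R[i]) t :
  (forall i, P i -> cderiv (F i) t (d i)) ->
  cderiv (fun s => \sum_(i <- r | P i) F i s) t (\sum_(i <- r | P i) d i).
Proof.
move=> h; elim: r => [|i r IH].
  by rewrite big_nil; under eq_fun do rewrite big_nil; exact: cderiv_cst.
rewrite big_cons (_ : (fun s => _) = fun s => if P i then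
    F i s + \sum_(i <- r | P i) F i s else \sum_(i <- r | P i) F i s).
  by case: (boolP (P i)) => // Pi; apply: cderivD => //; exact: h.
by apply/funext => s; rewrite big_cons.
Qed.

Lemma cderiv_cexp u t d : cderiv u t d ->
  cderiv (fun s => cexp (u s)) t (d * cexp (u t)).
Proof.
move=> [u1 u2].
have e1 := is_derive1_comp (is_derive_expR (complex.Re (u t))) u1.
have e2 := is_derive1_comp (is_derive_cos (complex.Im (u t))) u2.
have e3 := is_derive1_comp (is_derive_sin (complex.Im (u t))) u2.
split.
- rewrite (_ : (fun s => _) = (expR \o (fun s => complex.Re (u s))) *
    (@cos R \o (fun s => complex.Im (u s)))); last first.
    by apply/funext => s; rewrite !fctE /cexp /= mul0r subr0.
  apply: is_derive_eq; rewrite /= /GRing.scale /=.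
  by case: d (u t) {u1 u2 e1 e2 e3} => [? ?] [? ?] /=; ring.
- rewrite (_ : (fun s => _) = (expR \o (fun s => complex.Re (u s))) *
    (@sin R \o (fun s => complex.Im (u s)))); last first.
    by apply/funext => s; rewrite !fctE /cexp /= mul0r addr0.
  apply: is_derive_eq; rewrite /= /GRing.scale /=.
  by case: d (u t) {u1 u2 e1 e2 e3} => [? ?] [? ?] /=; ring.
Qed.

Lemma cderiv_real (w : R -> R) t (d : R) : is_derive t 1 w d ->
  cderiv (fun s => (w s)%:C) t d%:C.
Proof. by move=> h; split => //=; exact: is_derive_cst. Qed.

Lemma is_deriveMl (c : R) (w : R -> R) t (d : R) : is_derive t 1 w d ->
  is_derive t 1 (fun s => c * w s) (c * d).
Proof. exact: (@is_deriveZ R R R w c t 1 d). Qed.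

Lemma is_derive_expR_comp (w : R -> R) t (d : R) : is_derive t 1 w d ->
  is_derive t 1 (fun s => expR (w s)) (d * expR (w t)).
Proof. by rewrite mulrC => h; exact: (is_derive1_comp (is_derive_expR _) h). Qed.

Lemma has_derivativeE n (u : R -> 'cV[R[i]]_n) t d :
  has_derivative u t d <-> forall i, cderiv (fun s => u s i 0) t (d i 0).
Proof. by []. Qed.

Lemma is_derive_sqr_normc u t d : cderiv u t d ->
  is_derive t 1 (fun s => normc (u s) ^+ 2)
    (2 * (complex.Re (u t) * complex.Re d + complex.Im (u t) * complex.Im d)).
Proof.
move=> [u1 u2].
rewrite (_ : (fun s => _) = (fun s => complex.Re (u s)) ^+ 2 +
   (fun s => complex.Im (u s)) ^+ 2); last first.
  by apply/funext => s; rewrite normc2E !fctE.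
by apply: is_derive_eq; rewrite /= /GRing.scale /= !expr1; ring.
Qed.

End Derivatives.

(** * Comparison argument for a scalar differential inequality *)

Section Decay.
Variables (R : realType) (m : nat).
Local Notation ell := (@Liter R m.+1).

(* For large [K] the function [K exp (- s ell)] is a supersolution of
   [phi' = - a phi + C exp (- s ell)], because [ell' --> 0]. *)
Lemma exp_decay (phi dphi : R -> R) (a C s : R) : 0 < a ->
  (\forall t \near +oo, is_derive (t : R) 1 phi (dphi t)) ->
  (\forall t \near +oo, dphi t <= - a * phi t + C * expR (- s * ell t)) ->
  exists K, \forall t \near +oo, phi t <= K * expR (- s * ell t).
Proof.
move=> a0 hd hle.
have : \forall t \near +oo, [/\ is_derive (t : R) 1 phi (dphi t),
   dphi t <= - a * phi t + C * expR (- s * ell t),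
   is_derive t 1 ell (dLiter m.+1 t) & s * dLiter m.+1 t <= a / 2].
  near=> t; split.
  - by near: t.
  - by near: t.
  - apply: is_derive_Liter; near: t; exact: near_Liter_gtn.
  - have t0 : 0 < t by near: t; apply: nbhs_pinfty_gt; exact: num_real.
    have /andP[d0 d1] : 0 <= dLiter m.+1 t <= t^-1 by near: t; exact: near_dLiter.
    have h : `|s| / (a / 2) <= t by near: t; apply: nbhs_pinfty_ge; exact: num_real.
    apply: (le_trans (ler_norm _)); rewrite normrM (ger0_norm d0).
    apply: (le_trans (ler_wpM2l (normr_ge0 _) d1)).
    by rewrite ler_pdivrMr// mulrC -ler_pdivrMr// divr_gt0.
move=> [T [_ hT]]; pose T1 := T + 1.
have T1T (t : R) : T1 <= t -> T < t by rewrite /T1; lra.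
(* The first summand gives C <= K a / 2; the second puts phi(T1) below K exp(- s ell(T1)). *)
pose K : R := `|2 * C / a| + `|phi T1 / expR (- s * ell T1)|.
have K0 : 0 <= K by rewrite addr_ge0.
have KC : C <= K * (a / 2).
  apply: (@le_trans _ _ (2 * C / a * (a / 2))).
    have -> : 2 * C / a * (a / 2) = C by field; lra.
    by [].
  rewrite ler_wpM2r//; first lra.
  by rewrite (le_trans (ler_norm _))// /K lerDl.
have Kphi : phi T1 <= K * expR (- s * ell T1).
  rewrite -ler_pdivrMr ?expR_gt0//.
  by rewrite (le_trans (ler_norm _))// /K lerDr.
pose h (t : R) : R := K * expR (- s * ell t).
(* The integrating factor exp(a t) turns the inequality into monotonicity of [psi]: the forcing and
   the term s ell' h each use at most (a / 2) h. Being nonpositive at [T1], [psi] stays so. *)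
pose psi : R -> R := (fun t => expR (a * t)) * (phi - h).
pose dpsi (t : R) : R := expR (a * t) * (a * (phi t - h t) + (dphi t + s * dLiter m.+1 t * h t)).
have psiD t : T < t -> is_derive t 1 psi (dpsi t).
  move=> /hT[d1 _ d2 _].
  have e1 : is_derive t 1 (fun t => expR (a * t)) (a * 1 * expR (a * t)).
    by apply: is_derive_expR_comp; apply: is_deriveMl; exact: is_derive_id.
  have e2 : is_derive t 1 h (K * (- s * dLiter m.+1 t * expR (- s * ell t))).
    by apply: is_deriveMl; apply: is_derive_expR_comp; exact: is_deriveMl.
  apply: is_derive_eq; rewrite /dpsi /= /GRing.scale /= !fctE /h; ring.
exists K; exists T1; split; first exact: num_real.
move=> t T1t.
have : psi t <= psi T1.
  apply: (@ler0_derive1_nincry _ psi T1) => //; last by rewrite ltW.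
  - by move=> x; rewrite in_itv /= andbT => /ltW/T1T/psiD[].
  - move=> x; rewrite in_itv /= andbT => /ltW/T1T Tx.
    have [_ h1 _ h2] := hT _ Tx.
    rewrite derive1E (@derive_val _ _ _ _ _ _ _ (psiD _ Tx)) /dpsi.
    rewrite mulr_ge0_le0 ?expR_ge0//.
    have h0 : 0 <= h x by rewrite mulr_ge0// expR_ge0.
    have h3 : s * dLiter m.+1 x * h x <= a / 2 * h x by rewrite ler_wpM2r.
    have h4 : C * expR (- s * ell x) <= a / 2 * h x.
      by rewrite /h mulrA ler_wpM2r ?expR_ge0// mulrC.
    lra.
  - apply: derivable_within_continuous => x; rewrite in_itv /= andbT => T1x.
    by have [] := psiD _ (T1T _ T1x).
have psi1 : psi T1 <= 0.
  by rewrite /psi !fctE mulr_ge0_le0 ?expR_ge0// subr_le0.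
move=> /le_trans/(_ psi1); rewrite /psi !fctE pmulr_rle0 ?expR_gt0//.
by rewrite subr_le0.
Unshelve. all: end_near. Qed.

End Decay.

(** * Euclidean norm and real inner product on C^n *)

Section EuclideanNorm.
Variables (R : realType) (n : nat).
Implicit Types (x y : 'cV[R[i]]_n) (a b : R[i]).

Lemma sqr_enorm x : enorm x ^+ 2 = \sum_(i < n) normc (x i 0) ^+ 2.
Proof.
rewrite /enorm sqr_sqrtr; first by apply: eq_bigr => i _; rewrite normc2E.
by apply: sumr_ge0 => i _; rewrite addr_ge0 ?sqr_ge0.
Qed.

Lemma enorm_ge0 x : 0 <= enorm x. Proof. exact: sqrtr_ge0. Qed.

Lemma normc_le_enorm x i : normc (x i 0) <= enorm x.
Proof.
rewrite -(@ler_pXn2r _ 2)// ?nnegrE ?normc_ge0 ?enorm_ge0// sqr_enorm.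
by rewrite (bigD1 i)//= lerDl sumr_ge0// => j _; rewrite sqr_ge0.
Qed.

Lemma enorm_le_sum x : enorm x <= \sum_(i < n) normc (x i 0).
Proof.
have S0 : 0 <= \sum_(i < n) normc (x i 0).
  by apply: sumr_ge0 => i _; exact: normc_ge0.
rewrite -(@ler_pXn2r _ 2)// ?nnegrE ?enorm_ge0// sqr_enorm expr2 mulr_sumr.
apply: ler_sum => i _; rewrite expr2 ler_wpM2r ?normc_ge0//.
by rewrite (bigD1 i)//= lerDl sumr_ge0// => j _; rewrite normc_ge0.
Qed.

Lemma enorm_mulmx (Q : 'M[R[i]]_n) :
  exists2 K : R, 0 < K & forall x, enorm (Q *m x) <= K * enorm x.
Proof.
exists (1 + \sum_(i < n) \sum_(j < n) normc (Q i j)).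
  by rewrite ltr_wpDr// sumr_ge0// => i _; rewrite sumr_ge0// => j _; exact: normc_ge0.
move=> x; rewrite mulrDl mul1r ler_wpDl ?enorm_ge0//.
apply: (le_trans (enorm_le_sum _)); rewrite mulr_suml; apply: ler_sum => i _.
rewrite mxE (le_trans (ler_normc_sum _ _ _))// mulr_suml; apply: ler_sum => j _.
by rewrite normcM ler_wpM2l ?normc_ge0// normc_le_enorm.
Qed.

(** The inner product of the plane R^2 = C, that is the real part of conj(a) b. *)
Definition rdotc a b : R :=
  complex.Re a * complex.Re b + complex.Im a * complex.Im b.

Lemma rdotcDr a b c : rdotc a (b + c) = rdotc a b + rdotc a c.
Proof. by case: a b c => [? ?] [? ?] [? ?]; rewrite /rdotc /=; ring. Qed.

Lemma rdotc0 a : rdotc a 0 = 0.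
Proof. by rewrite /rdotc /= !mulr0 addr0. Qed.

Lemma rdotc_sumr a (I : Type) (r : seq I) (F : I -> R[i]) :
  rdotc a (\sum_(i <- r) F i) = \sum_(i <- r) rdotc a (F i).
Proof. exact: (big_morph _ (rdotcDr a) (rdotc0 a)). Qed.

Lemma rdotcMr a b : rdotc a (b * a) = complex.Re b * normc a ^+ 2.
Proof. by rewrite normc2E; case: a b => [? ?] [? ?]; rewrite /rdotc /=; ring. Qed.

(** Cauchy-Schwarz in the plane, from Lagrange's identity: the defect is the square of p s - q r. *)
Lemma ler_rdotc a b : `|rdotc a b| <= normc a * normc b.
Proof.
rewrite -(@ler_pXn2r _ 2)// ?nnegrE ?mulr_ge0 ?normc_ge0//
  (real_normK (num_real _)) exprMn !normc2E.
rewrite -subr_ge0 /rdotc; case: a b => [p q] [r s] /=.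
have -> : (p ^+ 2 + q ^+ 2) * (r ^+ 2 + s ^+ 2) - (p * r + q * s) ^+ 2 =
  (p * s - q * r) ^+ 2 by ring.
exact: sqr_ge0.
Qed.

Definition rdot x y : R := \sum_(i < n) rdotc (x i 0) (y i 0).

Lemma rdotDr x y z : rdot x (y + z) = rdot x y + rdot x z.
Proof. by rewrite /rdot -big_split; apply: eq_bigr => i _; rewrite mxE rdotcDr. Qed.

Lemma rdotNr x y : rdot x (- y) = - rdot x y.
Proof.
rewrite /rdot -sumrN; apply: eq_bigr => i _.
by rewrite mxE /rdotc; case: (x i 0) (y i 0) => [? ?] [? ?] /=; ring.
Qed.

(** Young's inequality: in each coordinate, (c p - q)^2 / c >= 0 combined with Cauchy-Schwarz. *)
Lemma rdot_young x y (c : R) : 0 < c ->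
  2 * rdot x y <= c * enorm x ^+ 2 + c^-1 * enorm y ^+ 2.
Proof.
move=> c0; rewrite !sqr_enorm !mulr_sumr -big_split; apply: ler_sum => i _ /=.
have := ler_rdotc (x i 0) (y i 0); move: (normc (x i 0)) (normc (y i 0)) => p q.
move=> /(le_trans (ler_norm _)) h.
have : 0 <= c^-1 * (c * p - q) ^+ 2 by rewrite mulr_ge0 ?sqr_ge0 ?invr_ge0 ?ltW.
have -> : c^-1 * (c * p - q) ^+ 2 = c * p ^+ 2 + c^-1 * q ^+ 2 - 2 * (p * q).
  by field; lra.
lra.
Qed.

Lemma is_derive_sqr_enorm (v : R -> 'cV[R[i]]_n) (t : R) d : has_derivative v t d ->
  is_derive t 1 (fun s => enorm (v s) ^+ 2) (2 * rdot (v t) d).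
Proof.
move=> h; rewrite (_ : (fun s => _) = \sum_(i < n) (fun s => normc (v s i 0) ^+ 2)).
  rewrite /rdot mulr_sumr; apply: is_derive_sum => i.
  exact: is_derive_sqr_normc.
by apply/funext => s; rewrite sqr_enorm fct_sumE.
Qed.

Lemma has_derivative_mulmx (Q : 'M[R[i]]_n) (v : R -> 'cV[R[i]]_n) (t : R) d :
  has_derivative v t d -> has_derivative (fun s => Q *m v s) t (Q *m d).
Proof.
move=> /has_derivativeE h; apply/has_derivativeE => i; rewrite mxE.
rewrite (_ : (fun s => _) = fun s => \sum_j Q i j * v s j 0).
  by apply: cderiv_sum => j _; exact: cderivMl.
by apply/funext => s; rewrite mxE.
Qed.

Lemma has_derivativeD (u v : R -> 'cV[R[i]]_n) (t : R) d e :
  has_derivative u t d -> has_derivative v t e ->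
  has_derivative (fun s => u s + v s) t (d + e).
Proof.
move=> /has_derivativeE hu /has_derivativeE hv; apply/has_derivativeE => i.
rewrite mxE (_ : (fun s => _) = fun s => u s i 0 + v s i 0); first exact: cderivD.
by apply/funext => s; rewrite mxE.
Qed.

Lemma has_derivativeN (u : R -> 'cV[R[i]]_n) (t : R) d :
  has_derivative u t d -> has_derivative (fun s => - u s) t (- d).
Proof.
move=> /has_derivativeE hu; apply/has_derivativeE => i.
rewrite mxE -mulN1r (_ : (fun s => _) = fun s => -1 * u s i 0); first exact: cderivMl.
by apply/funext => s; rewrite mxE mulN1r.
Qed.

End EuclideanNorm.

(** * A coercive norm and the stability of the linear equation *)

Section Lyapunov.
Variables (R : realType) (n : nat) (A : 'M[R[i]]_n).
Hypothesis n_gt0 : (0 < n)%N.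
Hypothesis A_eig : forall a : R[i], eigenvalue A a -> 0 < complex.Re a.

(** [P] is Schur's unitary matrix. The diagonal entries of the triangular matrix are roots of its
    characteristic polynomial, and conjugation by an invertible matrix creates no new eigenvalue. *)
Lemma trigonalization : exists2 P : 'M[R[i]]_n, P \in unitmx &
  exists2 T : 'M[R[i]]_n, P *m A = T *m P &
    is_trig_mx T /\ forall i, 0 < complex.Re (T i i).
Proof.
have [P /unitarymx_unit uP trig] := Schur A n_gt0.
exists P => //; exists (conjmx P A).
  by rewrite conjumx// mulmxKV.
split=> // i; apply: A_eig.
have := @eigenvalue_conjmx _ _ _ P A; rewrite stablemx_unit// row_free_unit.
move=> /(_ isT uP); apply.
rewrite [_ \in _]eigenvalue_root_char char_poly_trig//.
by rewrite rootE horner_prod (bigD1 i)//= hornerXsubC subrr mul0r.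
Qed.

Lemma finite_pos_lb (F : 'I_n -> R) : (forall i, 0 < F i) ->
  exists2 c, 0 < c & forall i, c <= F i.
Proof.
move=> F0; exists (\big[Order.min/1]_(i < n) F i).
  by elim/big_ind : _ => // x y x0 y0; rewrite lt_min x0.
by move=> i; exact: bigmin_le.
Qed.

(* Conjugating a triangular matrix by diag(e^i) multiplies its strictly
   triangular part by powers of e, making it negligible. *)
Lemma coercive_norm : exists2 Q : 'M[R[i]]_n, Q \in unitmx &
  exists2 c : R, 0 < c &
    forall x, c * enorm (Q *m x) ^+ 2 <= rdot (Q *m x) (Q *m (A *m x)).
Proof.
have [P uP [T PA [trig diag]]] := trigonalization.
have {}PA (x : 'cV_n) : P *m (A *m x) = T *m (P *m x).
  by rewrite mulmxA PA mulmxA.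
have [c0 c00 c0T] := finite_pos_lb diag.
pose M := \sum_(i < n) \sum_(j < n) normc (T i j).
have M0 : 0 <= M.
  by apply: sumr_ge0 => i _; apply: sumr_ge0 => j _; exact: normc_ge0.
(* [e * M <= c0 / 2] keeps the off-diagonal part below half of the diagonal one; [e <= 1] gives e^(i
   - j) <= e for i > j. *)
pose e := Num.min 1 (c0 / (2 * (M + 1))).
have e0 : 0 < e by rewrite lt_min ltr01 /= divr_gt0// mulr_gt0// ltr_wpDl.
have e1 : e <= 1 by rewrite ge_min lexx.
have eM : e * M <= c0 / 2.
  apply: (@le_trans _ _ (c0 / (2 * (M + 1)) * (M + 1))); last first.
    by rewrite le_eqVlt; apply/orP; left; apply/eqP; field; lra.
  by apply: ler_pM; rewrite ?(ltW e0)// ?ge_min ?lexx ?orbT// lerDl.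
pose D := diag_mx (\row_(i < n) ((e ^+ i)%:C : R[i])).
have uD : D \in unitmx.
  rewrite unitmxE det_diag unitfE; apply/prodf_neq0 => i _; rewrite mxE.
  by rewrite (inj_eq (@complexI R)) expf_neq0// gt_eqF.
exists (D *m P); first by rewrite unitmx_mul uD.
exists (c0 / 2) => [|x]; first by rewrite divr_gt0.
rewrite -!mulmxA PA; move: (P *m x) => v.
have DE (u : 'cV[R[i]]_n) i : (D *m u) i 0 = (e ^+ i)%:C * u i 0.
  by rewrite mul_diag_mx !mxE.
set w := D *m v; set E := enorm w ^+ 2.
have E0 : 0 <= E by rewrite sqr_ge0.
(* Diagonal entries give at least c0 |w_i|^2, entries above the diagonal vanish, and those below
   carry e^(i - j) <= e. Subtracting e |T_ij| E in all three cases lets one double sum bound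
   everything. *)
have key i j : (if i == j then c0 * normc (w i 0) ^+ 2 else 0) - e * normc (T i j) * E <=
    rdotc (w i 0) ((e ^+ i)%:C * (T i j * v j 0)).
  have eTE k : 0 <= e * normc (T i k) * E by rewrite mulr_ge0// mulr_ge0 ?normc_ge0 ?(ltW e0).
  have [<-|ij] := eqVneq i j.
    have -> : (e ^+ i)%:C * (T i i * v i 0) = T i i * w i 0.
      by rewrite DE mulrCA.
    rewrite rdotcMr.
    have : c0 * normc (w i 0) ^+ 2 <= complex.Re (T i i) * normc (w i 0) ^+ 2.
      by rewrite ler_wpM2r ?sqr_ge0.
    by have := eTE i; lra.
  rewrite sub0r; have [ltij|ltji] := ltnP i j.
    move: (eTE j); rewrite (is_trig_mxP trig)// mul0r mulr0 rdotc0.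
    by rewrite oppr_le0.
  have {ij}ltji : (j < i)%N by rewrite ltn_neqAle ltji eq_sym andbT.
  have -> : (e ^+ i)%:C * (T i j * v j 0) = (e ^+ (i - j))%:C * T i j * w j 0.
    rewrite DE -{1}(subnK (ltnW ltji)) exprD rmorphM /=; ring.
  rewrite lerNl; apply: (le_trans (ler_norm _)); rewrite normrN.
  apply: (le_trans (ler_rdotc _ _)); rewrite !normcM normc_real.
  rewrite ger0_norm ?exprn_ge0 ?(ltW e0)//.
  have -> : normc (w i 0) * (e ^+ (i - j) * normc (T i j) * normc (w j 0)) =
    e ^+ (i - j) * normc (T i j) * (normc (w i 0) * normc (w j 0)) by ring.
  apply: ler_pM; rewrite ?mulr_ge0 ?normc_ge0 ?exprn_ge0 ?(ltW e0)//.
    rewrite ler_wpM2r ?normc_ge0//.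
    have : (0 < i - j)%N by rewrite subn_gt0.
    case: (i - j)%N => // k _; rewrite exprS ler_piMr ?(ltW e0)//.
    by rewrite exprn_ile1 ?(ltW e0).
  by rewrite /E expr2 ler_pM ?normc_ge0 ?normc_le_enorm.
have -> : rdot w (D *m (T *m v)) =
    \sum_(i < n) \sum_(j < n) rdotc (w i 0) ((e ^+ i)%:C * (T i j * v j 0)).
  rewrite /rdot; apply: eq_bigr => i _; rewrite -rdotc_sumr.
  by congr (rdotc _ _); rewrite DE mxE mulr_sumr.
have : \sum_(i < n) \sum_(j < n) ((if i == j then c0 * normc (w i 0) ^+ 2 else 0)
    - e * normc (T i j) * E) <=
    \sum_(i < n) \sum_(j < n) rdotc (w i 0) ((e ^+ i)%:C * (T i j * v j 0)).
  by apply: ler_sum => i _; apply: ler_sum.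
apply: le_trans.
have -> : \sum_(i < n) \sum_(j < n) ((if i == j then c0 * normc (w i 0) ^+ 2 else 0)
    - e * normc (T i j) * E) = c0 * E - e * M * E.
  rewrite /E {2}sqr_enorm /M !mulr_sumr mulr_suml -sumrB; apply: eq_bigr => i _.
  rewrite sumrB; congr (_ - _); last by rewrite -mulrA mulr_suml mulr_sumr;
    apply: eq_bigr => j _; rewrite mulrA.
  by rewrite -big_mkcond /= (big_pred1 i)// => j; rewrite eq_sym.
have : e * M * E <= c0 / 2 * E by rewrite ler_wpM2r.
lra.
Qed.

(** The norm of [coercive_norm] reduces the equation to a scalar inequality for |Q v|^2, to which
    [exp_decay] applies. The tolerance eps |v|^2 on the forcing later absorbs the nonlinearity;
    exponents are doubled because norms are squared. *)
Lemma stable_ord (m : nat) : exists2 eps : R, 0 < eps &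
  forall (sig : R) (v g : R -> 'cV[R[i]]_n),
    (\forall t \near +oo, has_derivative v t (- (A *m v t) + g t)) ->
    (forall s, s < sig -> \forall t \near +oo,
       enorm (g t) ^+ 2 <= eps * enorm (v t) ^+ 2 + expR (- (2 * s) * Liter m.+1 t)) ->
    forall i, ord m sig (fun t => v t i 0).
Proof.
have [Q uQ [c c0 coer]] := coercive_norm.
have [K K0 KQ] := enorm_mulmx Q.
have [K' K'0 KQ'] := enorm_mulmx (invmx Q).
have sqrQ x : enorm (Q *m x) ^+ 2 <= K ^+ 2 * enorm x ^+ 2.
  by rewrite -exprMn ler_pXn2r// nnegrE ?enorm_ge0// mulr_ge0 ?enorm_ge0// ltW.
have sqrQ' x : enorm x ^+ 2 <= K' ^+ 2 * enorm (Q *m x) ^+ 2.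
  rewrite -exprMn ler_pXn2r// ?nnegrE ?enorm_ge0// ?mulr_ge0 ?enorm_ge0 ?(ltW K'0)//.
  by rewrite -{1}(mulKmx uQ x) KQ'.
(* Young's inequality leaves the decay rate c. This choice makes the feedback term c^-1 K^2 eps K'^2
   phi equal to (c / 2) phi, so the rate c / 2 remains. *)
pose eps := c ^+ 2 / (2 * K ^+ 2 * K' ^+ 2).
have eps0 : 0 < eps by rewrite divr_gt0 ?exprn_gt0 ?mulr_gt0 ?exprn_gt0.
exists eps => // sig v g hd hg i s ssig.
have [s1 s2] := midf_lt ssig; set s' := (s + sig) / 2 in s1 s2.
pose phi (t : R) : R := enorm (Q *m v t) ^+ 2.
pose dphi (t : R) : R := 2 * rdot (Q *m v t) (Q *m (- (A *m v t) + g t)).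
have hphi : \forall t \near +oo, is_derive (t : R) 1 phi (dphi t).
  near=> t; apply: is_derive_sqr_enorm; apply: has_derivative_mulmx.
  by near: t.
have a0 : 0 < c / 2 by rewrite divr_gt0.
have hle : \forall t \near +oo, dphi t <= - (c / 2) * phi t +
    c^-1 * K ^+ 2 * expR (- (2 * s') * Liter m.+1 t).
  near=> t; rewrite /dphi mulmxDr mulmxN rdotDr rdotNr mulrDr.
  have h1 := coer (v t); rewrite -/(phi t) in h1.
  have h2 := rdot_young (Q *m v t) (Q *m g t) c0; rewrite -/(phi t) in h2.
  have h3 : enorm (g t) ^+ 2 <= eps * enorm (v t) ^+ 2 + expR (- (2 * s') * Liter m.+1 t).
    by near: t; exact: hg.
  have h4 : c^-1 * enorm (Q *m g t) ^+ 2 <= c^-1 * (K ^+ 2 *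
      (eps * (K' ^+ 2 * phi t) + expR (- (2 * s') * Liter m.+1 t))).
    rewrite ler_wpM2l ?invr_ge0 ?(ltW c0)// (le_trans (sqrQ _))//.
    rewrite ler_wpM2l ?sqr_ge0// (le_trans h3)// lerD2r.
    by rewrite ler_wpM2l ?(ltW eps0)// sqrQ'.
  have h5 : c^-1 * (K ^+ 2 * (eps * (K' ^+ 2 * phi t) + expR (- (2 * s') * Liter m.+1 t))) =
    c / 2 * phi t + c^-1 * K ^+ 2 * expR (- (2 * s') * Liter m.+1 t).
    rewrite /eps; field; lra.
  lra.
have [C hC] := exp_decay a0 hphi hle.
near=> t.
rewrite -(@ler_pXn2r _ 2)// ?nnegrE ?normc_ge0 ?expR_ge0//.
have h1 : phi t <= C * expR (- (2 * s') * Liter m.+1 t) by near: t.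
have h2 : K' ^+ 2 * C * expR (- (2 * s') * Liter m.+1 t) <= expR (- (2 * s) * Liter m.+1 t).
  by near: t; apply: near_absorb; lra.
have -> : expR (- s * Liter m.+1 t) ^+ 2 = expR (- (2 * s) * Liter m.+1 t).
  by rewrite -expRM_natl; congr expR; rewrite -mulr_natl; ring.
apply: le_trans h2; rewrite -mulrA.
apply: (@le_trans _ _ (enorm (v t) ^+ 2)).
  by rewrite ler_pXn2r ?nnegrE ?normc_ge0 ?enorm_ge0// normc_le_enorm.
rewrite (le_trans (sqrQ' _))// ler_wpM2l ?sqr_ge0//.
Unshelve. all: end_near. Qed.

(** A nonzero kernel would make - a an eigenvalue of [A] with real part 0. *)
Lemma shift_unitmx (a : R[i]) : complex.Re a = 0 -> A + a%:M \in unitmx.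
Proof.
move=> a0; rewrite -row_free_unit -kermx_eq0.
apply: contraT => ne; have /A_eig : eigenvalue A (- a).
  by rewrite /eigenvalue /eigenspace raddfN opprK.
by case: a a0 {ne} => [p q] /= ->; rewrite oppr0 ltxx.
Qed.

End Lyapunov.

(** * Expansion of multilinear maps *)

Section Multilinear.
Variables (R : realType) (n : nat).
Local Notation V := 'cV[R[i]]_n.

(** Inductions on the arity split off the argument of index 0; [fcons] undoes the split. *)
Definition fcons (m : nat) (w : V) (x : 'I_m -> V) (i : 'I_m.+1) : V :=
  if unlift ord0 i is Some i' then x i' else w.

Lemma fcons0 m (w : V) (x : 'I_m -> V) : fcons w x ord0 = w.
Proof. by rewrite /fcons unlift_none. Qed.

Lemma fcons_lift m (w : V) (x : 'I_m -> V) i : fcons w x (lift ord0 i) = x i.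
Proof. by rewrite /fcons liftK. Qed.

Lemma fcons_eta m (x : 'I_m.+1 -> V) : fcons (x ord0) (fun i => x (lift ord0 i)) = x.
Proof.
apply/funext => i; have [i' ->|->] := unliftP ord0 i.
  by rewrite fcons_lift.
by rewrite fcons0.
Qed.

Lemma multilinear_fcons m (g : ('I_m.+1 -> V) -> V) (w : V) :
  multilinear_map g -> multilinear_map (fun x => g (fcons w x)).
Proof.
move=> gl i x c u v.
have E (a : V) : fcons w (fun j => if j == i then a else x j) =
    fun j => if j == lift ord0 i then a else fcons w x j.
  apply/funext => j; have [j' ->|->] := unliftP ord0 j.
    by rewrite !fcons_lift (inj_eq lift_inj).
  by rewrite !fcons0.
by rewrite !E gl.
Qed.

Lemma multilinear_fconsl m (g : ('I_m.+1 -> V) -> V) (x : 'I_m -> V)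
    (I : Type) (r : seq I) (c : I -> R[i]) (u : I -> V) :
  multilinear_map g ->
  g (fcons (\sum_(k <- r) c k *: u k) x) = \sum_(k <- r) c k *: g (fcons (u k) x).
Proof.
move=> gl.
have lin a v w : g (fcons (a *: v + w) x) = a *: g (fcons v x) + g (fcons w x).
  have E (b : V) : fcons b x = fun j => if j == ord0 then b else fcons 0 x j.
    apply/funext => j; have [j' ->|->] := unliftP ord0 j.
      by rewrite !fcons_lift.
    by rewrite fcons0 eqxx.
  by rewrite (E (_ + _)) gl -!E.
elim: r => [|k r IH]; last by rewrite !big_cons lin IH.
(* For the empty sum: the value at first argument 0 equals twice itself, hence vanishes. *)
rewrite !big_nil; have := lin 1 0 0; rewrite !scale1r addr0.
by move=> /eqP; rewrite -subr_eq0 opprD addrA subrr add0r oppr_eq0 => /eqP.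
Qed.

(** Induction on the arity: the first argument is expanded by linearity, the others by the induction
    hypothesis for the map with that argument fixed. *)
Lemma multilinear_expand (K : finType) m (g : ('I_m -> V) -> V)
    (c : 'I_m -> K -> R[i]) (u : K -> V) : multilinear_map g ->
  g (fun l => \sum_k c l k *: u k) =
  \sum_(j : {ffun 'I_m -> K}) (\prod_l c l (j l)) *: g (fun l => u (j l)).
Proof.
elim: m g c => [|m IH] g c gl.
  rewrite (big_pred1 (ffun0 (card_ord 0))); last by move=> j; apply/esym/eqP/ffunP => -[].
  by rewrite big_ord0 scale1r; congr g; apply/funext => -[].
rewrite -[fun l => _]fcons_eta multilinear_fconsl//.
(* [h] glues the index chosen for the first argument to those of the remaining ones, bijectively. *)
pose h (p : K * {ffun 'I_m -> K}) : {ffun 'I_m.+1 -> K} :=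
  [ffun i => if unlift ord0 i is Some i' then p.2 i' else p.1].
have h0 p : h p ord0 = p.1 by rewrite ffunE unlift_none.
have hl p i : h p (lift ord0 i) = p.2 i by rewrite ffunE liftK.
rewrite [RHS](reindex h) /=; last first.
  exists (fun f => (f ord0, [ffun i => f (lift ord0 i)])).
    move=> [k f] _; congr (_, _); first exact: h0.
    by apply/ffunP => i; rewrite ffunE hl.
  move=> f _; apply/ffunP => i; have [i' ->|->] := unliftP ord0 i.
    by rewrite hl ffunE.
  by rewrite h0.
rewrite -(pair_bigA _ (fun k f => (\prod_l c l (h (k, f) l)) *: g (fun l => u (h (k, f) l)))) /=.
apply: eq_bigr => k _; rewrite (IH (fun x => g (fcons (u k) x))); last exact: multilinear_fcons.
rewrite scaler_sumr; apply: eq_bigr => f _.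
rewrite scalerA big_ord_recl h0 /=; congr (_ *: _).
  by congr (_ * _); apply: eq_bigr => l _; rewrite hl.
congr g; apply/funext => i; have [i' ->|->] := unliftP ord0 i.
  by rewrite fcons_lift hl.
by rewrite fcons0 h0.
Qed.

(** Expansion in the standard basis. Each coordinate becomes a polynomial in the coordinates of the
    arguments, so closure properties of scalar functions carry over to vectors. *)
Lemma multilinear_coord m (g : ('I_m -> V) -> V) (x : 'I_m -> V) (i : 'I_n) :
  multilinear_map g ->
  g x i 0 = \sum_(j : {ffun 'I_m -> 'I_n})
     (\prod_l x l (j l) 0) * g (fun l => delta_mx (j l) 0) i 0.
Proof.
move=> gl; have -> : x = fun l => \sum_(k < n) x l k 0 *: delta_mx k 0.
  apply/funext => l; rewrite [LHS]matrix_sum_delta; apply: eq_bigr => k _.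
  by rewrite big_ord1.
rewrite (multilinear_expand (fun l k => x l k 0) (fun k => delta_mx k 0) gl) summxE.
apply: eq_bigr => j _; rewrite mxE; congr (_ * _).
apply: eq_bigr => l _; rewrite summxE (bigD1 (j l))//= !mxE !eqxx mulr1 big1 ?addr0//.
by move=> k kj; rewrite !mxE eq_sym (negbTE kj) mulr0.
Qed.

End Multilinear.

(** * Finite sums of complex powers *)

Section PowerSums.
Variable R : realType.
Implicit Types (m : int) (k : nat) (mu : R).

Lemma vpowD k (z : 'rV[R]_k) a b : vpow z (a + b) = vpow z a * vpow z b.
Proof.
rewrite /vpow -big_split; apply: eq_bigr => j _.
by rewrite mxE /cpow mulrDl cexpD.
Qed.

Lemma cpow0 (t : R) : cpow t 0 = 1.
Proof. by rewrite /cpow mul0r cexp0. Qed.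

Lemma vpow0 k (z : 'rV[R]_k) : vpow z 0 = 1.
Proof. by rewrite /vpow big1// => j _; rewrite mxE cpow0. Qed.

Lemma expclassD m k mu1 mu2 (a b : 'rV[R[i]]_k.+2) :
  expclass m mu1 a -> expclass m mu2 b -> expclass m (mu1 + mu2) (a + b).
Proof.
move=> ha hb j; have [a1 a2] := ha j; have [b1 b2] := hb j.
have E : complex.Re ((a + b) 0 j) = complex.Re (a 0 j) + complex.Re (b 0 j).
  by rewrite mxE; case: (a 0 j) (b 0 j) => [? ?] [? ?].
by split => h; rewrite E; [rewrite a1// b1// addr0|rewrite a2// b2].
Qed.

Lemma expclass0 m k : expclass m 0 (0 : 'rV[R[i]]_k.+2).
Proof. by move=> j; rewrite mxE. Qed.

(** Exponents may repeat in the list, so that sums become concatenations and products become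
    pairwise combinations, without regrouping. [classP_psum] returns to distinct exponents. *)
Definition psum m k mu (p : 'rV[R]_k.+2 -> R[i]) : Prop :=
  exists2 s : seq ('rV[R[i]]_k.+2 * R[i]),
    (forall x, x \in s -> expclass m mu x.1) &
    forall z, positive_vec z -> p z = \sum_(x <- s) vpow z x.1 * x.2.

Section Closure.
Variables (m : int) (k : nat).
Implicit Types p q : 'rV[R]_k.+2 -> R[i].

Lemma psum_ext mu p q : (forall z, positive_vec z -> p z = q z) ->
  psum m mu p -> psum m mu q.
Proof. by move=> pq [s s1 s2]; exists s => // z z0; rewrite -pq// s2. Qed.

Lemma psum0 mu : psum m mu (fun _ : 'rV[R]_k.+2 => 0).
Proof. by exists [::] => // z _; rewrite big_nil. Qed.

Lemma psumD mu p q : psum m mu p -> psum m mu q -> psum m mu (fun z => p z + q z).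
Proof.
move=> [s s1 s2] [s' s1' s2']; exists (s ++ s').
  by move=> x; rewrite mem_cat => /orP[/s1|/s1'].
by move=> z z0; rewrite big_cat /= s2// s2'.
Qed.

Lemma psumM mu mu' p q : psum m mu p -> psum m mu' q ->
  psum m (mu + mu') (fun z => p z * q z).
Proof.
move=> [s s1 s2] [s' s1' s2'].
exists [seq (x.1 + x'.1, x.2 * x'.2) | x <- s, x' <- s'].
  move=> x /allpairsP[[a b] /= [/s1 h /s1' h' ->]]; exact: expclassD.
move=> z z0; rewrite big_allpairs_dep s2// s2'// mulr_suml; apply: eq_bigr => x _.
rewrite mulr_sumr; apply: eq_bigr => x' _ /=; rewrite vpowD; ring.
Qed.

Lemma psum_cst (c : R[i]) : psum m 0 (fun _ : 'rV[R]_k.+2 => c).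
Proof.
exists [:: (0, c)]; first by move=> x; rewrite inE => /eqP ->; exact: expclass0.
by move=> z _; rewrite big_seq1 vpow0 mul1r.
Qed.

Lemma psum_sum mu (I : Type) (r : seq I) (P : pred I) (F : I -> 'rV[R]_k.+2 -> R[i]) :
  (forall i, P i -> psum m mu (F i)) ->
  psum m mu (fun z => \sum_(i <- r | P i) F i z).
Proof.
move=> h; elim: r => [|i r IH].
  by apply: psum_ext (psum0 mu) => z _; rewrite big_nil.
have [Pi|Pi] := boolP (P i).
  by apply: psum_ext (psumD (h i Pi) IH) => z _; rewrite big_cons Pi.
by apply: psum_ext IH => z _; rewrite big_cons (negbTE Pi).
Qed.

Lemma psum_prod (I : Type) (r : seq I) (mu : I -> R) (F : I -> 'rV[R]_k.+2 -> R[i]) :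
  (forall i, psum m (mu i) (F i)) ->
  psum m (\sum_(i <- r) mu i) (fun z => \prod_(i <- r) F i z).
Proof.
move=> h; elim: r => [|i r IH].
  by rewrite big_nil; apply: psum_ext (psum_cst 1) => z _; rewrite big_nil.
by rewrite big_cons; apply: psum_ext (psumM (h i) IH) => z _; rewrite big_cons.
Qed.

Lemma psum_multilinear n d (g : ('I_d -> 'cV[R[i]]_n) -> 'cV[R[i]]_n)
    (mu : 'I_d -> R) (q : 'I_d -> 'rV[R]_k.+2 -> 'cV[R[i]]_n) :
  multilinear_map g ->
  (forall l i, psum m (mu l) (fun z => q l z i 0)) ->
  forall i, psum m (\sum_l mu l) (fun z => g (fun l => q l z) i 0).
Proof.
move=> gl h i.
have H : psum m (\sum_l mu l) (fun z => \sum_(j : {ffun 'I_d -> 'I_n})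
     (\prod_l q l z (j l) 0) * g (fun l => delta_mx (j l) 0) i 0).
  apply: psum_sum => j _; rewrite -[\sum_l mu l]addr0.
  by apply: psumM (psum_cst _); apply: psum_prod => l.
by apply: psum_ext H => z _; rewrite [RHS]multilinear_coord.
Qed.

Lemma classP_psum n mu (p : 'rV[R]_k.+2 -> 'cV[R[i]]_n) :
  classP m mu p <-> forall i, psum m mu (fun z => p z i 0).
Proof.
split=> [[S [xi [uS Scl Sp]]] i|h].
  exists [seq (a, xi a i 0) | a <- S]; first by move=> x /mapP[a /Scl h ->].
  move=> z z0; rewrite Sp// /power_sum summxE big_map; apply: eq_bigr => a _.
  by rewrite mxE.
have /choice[s hs] : forall i, exists s : seq ('rV[R[i]]_k.+2 * R[i]),
    (forall x, x \in s -> expclass m mu x.1) /\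
    forall z, positive_vec z -> p z i 0 = \sum_(x <- s) vpow z x.1 * x.2.
  by move=> i; have [s s1 s2] := h i; exists s.
(* The lists of all coordinates are merged into one list with vector coefficients; terms with equal
   exponents are grouped afterwards. *)
pose L := [seq (x.1, x.2 *: delta_mx i 0 : 'cV[R[i]]_n) | i <- enum 'I_n, x <- s i].
have Lcl x : x \in L -> expclass m mu x.1.
  by move=> /allpairsPdep[i [y [_ /(proj1 (hs i)) yc ->]]].
exists (undup (map fst L)), (fun b => \sum_(x <- L | x.1 == b) x.2); split.
- exact: undup_uniq.
- by move=> a; rewrite mem_undup => /mapP[x /Lcl xc ->].
move=> z z0.
have -> : p z = \sum_(x <- L) vpow z x.1 *: x.2.
  rewrite /L big_allpairs_dep /= big_enum /=.
  apply/matrixP => i j; rewrite ord1 (proj2 (hs i))// summxE (bigD1 i)//=.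
  rewrite [X in _ + X]big1 ?addr0 => [|l li]; last first.
    rewrite summxE big1// => x _; rewrite !mxE eq_sym (negbTE li) /=.
    by rewrite !mulr0.
  by rewrite summxE; apply: eq_bigr => x _; rewrite !mxE !eqxx /= mulr1.
rewrite /power_sum.
under [RHS]eq_bigr do rewrite scaler_sumr big_mkcond /=.
rewrite exchange_big /=; apply: eq_big_seq => x xL.
have xS : x.1 \in undup (map fst L) by rewrite mem_undup map_f.
rewrite (bigD1_seq x.1)//= ?undup_uniq// eqxx big1 ?addr0// => b bx.
by rewrite eq_sym (negbTE bx).
Qed.

End Closure.

Lemma restrict_vars_pos k k' (z : 'rV[R]_k'.+2) :
  positive_vec z -> positive_vec (restrict_vars k z).
Proof. by move=> z0 j; rewrite mxE. Qed.

(** Exponents are padded with zeros. Since m <= k, the component m, whose real part must be [mu], is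
    not among the padded ones. *)
Lemma psum_restrict (m : nat) k k' mu (p : 'rV[R]_k.+2 -> R[i]) :
  (m <= k)%N -> (k <= k')%N -> psum m mu p ->
  psum m mu (fun z : 'rV[R]_k'.+2 => p (restrict_vars k z)).
Proof.
move=> mk kk' [s s1 s2].
pose ext (a : 'rV[R[i]]_k.+2) : 'rV[R[i]]_k'.+2 :=
  \row_j (if (j < k.+2)%N then a 0 (inord j) else 0).
have ext_cl a : expclass m mu a -> expclass m mu (ext a).
  move=> ha j; rewrite mxE; case: ifP => jk.
    by have := ha (inord j); rewrite inordK.
  split => // h; exfalso; have : (j < k.+2)%N; last by rewrite jk.
  have : j%:Z = m.+1%:Z by rewrite -(addn1 m) PoszD -h subrK.
  by case=> ->; rewrite !ltnS.
have ext_pow (z : 'rV[R]_k'.+2) a : vpow (restrict_vars k z) a = vpow z (ext a).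
  pose F (j : nat) := cpow (z 0 (inord j)) (if (j < k.+2)%N then a 0 (inord j) else 0).
  transitivity (\prod_(j < k.+2) F j).
    by apply: eq_bigr => j _; rewrite mxE /F ltn_ord inord_val.
  transitivity (\prod_(j < k'.+2) F j); last first.
    by apply: eq_bigr => j _; rewrite mxE /F inord_val.
  rewrite (big_ord_widen k'.+2)// big_mkcond; apply: eq_bigr => j _.
  by rewrite /F; case: (ltnP j k.+2) => _ /=; rewrite ?cpow0.
exists [seq (ext x.1, x.2) | x <- s].
  by move=> x /mapP[y /s1 yc ->]; exact: ext_cl.
move=> z z0; rewrite s2; last exact: restrict_vars_pos.
by rewrite big_map; apply: eq_bigr => x _; rewrite ext_pow.
Qed.

(** For m >= 0 the exponent of e^t is purely imaginary, which brings the function into the domain of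
    Z_A. *)
Lemma expclassN1 (m k : nat) mu (a : 'rV[R[i]]_k.+2) :
  expclass m mu a -> expclass (-1) 0 a.
Proof.
move=> h j; have [h0 _] := h j; split => jm; last by apply: h0; rewrite jm.
by apply: h0; rewrite (lt_trans jm).
Qed.

End PowerSums.

(** * Order and derivative of powers of iterated logarithms *)

Section PowersOfLogarithms.
Variables (R : realType) (m : nat).
Implicit Types (k : nat) (mu sig : R).

(** The logarithm of entry j of [Lhat] is [Liter j t] for every j, entry 0 included because ln e^t =
    t; hence a uniform formula for all factors. *)
Lemma vpow_Lhat k (t : R) a :
  vpow (Lhat k t) a = \prod_(j < k.+2) cexp (a 0 j * (Liter j t)%:C).
Proof.
rewrite /vpow; apply: eq_bigr => j _; rewrite mxE /cpow; congr (cexp (_ * _%:C)).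
by case: (val j) => [|i] /=; rewrite ?expRK.
Qed.

Lemma cexp_sum (I : Type) (r : seq I) (P : pred I) (F : I -> R[i]) :
  cexp (\sum_(i <- r | P i) F i) = \prod_(i <- r | P i) cexp (F i).
Proof. exact: (big_morph (@cexp R) (@cexpD R) (@cexp0 R)). Qed.

Lemma near_Lhat_pos k : \forall t \near +oo, positive_vec (@Lhat R k t).
Proof.
near=> t => j; rewrite mxE; case: ifP => [_|j0]; first exact: expR_gt0.
have h : forall i, (i < k.+1)%N -> 0 < Liter i t by near: t; exact: near_Liter_gtn.
by apply: h; case: j j0 => -[].
Unshelve. all: end_near. Qed.

Lemma restrict_Lhat k k' (t : R) : (k <= k')%N ->
  restrict_vars k (Lhat k' t) = Lhat k t.
Proof.
move=> kk'; apply/rowP => j; rewrite !mxE inordK//.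
by rewrite (leq_trans (ltn_ord j))// !ltnS.
Qed.

Lemma normc_cexp_Liter (c : R[i]) j (t : R) :
  normc (cexp (c * (Liter j t)%:C)) = expR (complex.Re c * Liter j t).
Proof. by rewrite normc_cexp; case: c => a b /=; rewrite mulr0 subr0. Qed.

(** Entries before m + 1 contribute modulus 1, entry m + 1 is L_m and gives the order - mu, and
    powers of the later entries grow more slowly than every positive power of L_m. *)
Lemma ord_vpow_Lhat k mu (a : 'rV[R[i]]_k.+2) : (m <= k)%N -> expclass m mu a ->
  ord m (- mu) (fun t => vpow (Lhat k t) a).
Proof.
move=> mk ha.
pose sig (j : 'I_k.+2) : R := if j == m.+1 :> nat then - mu else 0.
have sigE : \sum_j sig j = - mu.
  have mk' : (m.+1 < k.+2)%N by rewrite !ltnS.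
  rewrite (bigD1 (Ordinal mk'))//= /sig eqxx big1 ?addr0// => j.
  by rewrite -val_eqE /= => /negbTE ->.
rewrite -sigE (_ : (fun t => _) = fun t => \prod_(j < k.+2) cexp (a 0 j * (Liter j t)%:C)).
  apply: ord_prod => j s; rewrite /sig.
  have [a1 a2] := ha j; have [jm|mj|jm] := ltngtP j m.+1 => hs.
  - near=> t; rewrite normc_cexp_Liter a1 ?mul0r ?expR0; last first.
      by rewrite ltrBlDr -PoszD addn1 ltz_nat.
    have l0 : 0 < Liter m.+1 t by near: t; exact: near_Liter_gt.
    by rewrite -expR0 ler_expR mulr_ge0 ?oppr_ge0 ?ltW.
  - near=> t; rewrite normc_cexp_Liter ler_expR.
    have l0 : 0 < Liter j t by near: t; exact: near_Liter_gt.
    set c := complex.Re _.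
    have c1 : 0 < `|c| + 1 by rewrite ltr_wpDl.
    have h : Liter j t <= (- s / (`|c| + 1)) * Liter m.+1 t.
      by near: t; apply: near_Liter_small => //; rewrite divr_gt0// oppr_gt0.
    apply: (@le_trans _ _ ((`|c| + 1) * Liter j t)).
      by rewrite ler_wpM2r ?(ltW l0)// (le_trans (ler_norm _))// lerDl.
    by rewrite -ler_pdivlMl// (le_trans h)// mulrA [_^-1 * _]mulrC.
  - near=> t; rewrite normc_cexp_Liter ler_expR a2; last first.
      by rewrite jm -(addn1 m) PoszD addrK.
    have l0 : 0 < Liter m.+1 t by near: t; exact: near_Liter_gt.
    by rewrite jm ler_wpM2r ?(ltW l0)//; lra.
by apply/funext => t; rewrite vpow_Lhat.
Unshelve. all: end_near. Qed.

Lemma psum_ord k mu (p : 'rV[R]_k.+2 -> R[i]) : (m <= k)%N -> psum m mu p ->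
  ord m (- mu) (fun t => p (Lhat k t)).
Proof.
move=> mk [s s1 s2].
have H : ord m (- mu) (fun t => \sum_(x <- s) vpow (Lhat k t) x.1 * x.2).
  rewrite (_ : (fun t => _) = fun t => \sum_(x <- s | x \in s) vpow (Lhat k t) x.1 * x.2).
    apply: ord_sum => x /s1 xc; rewrite -[- mu]addr0; apply: ordM.
      exact: ord_vpow_Lhat.
    exact: ord_cst.
  by apply/funext => t; rewrite -big_seq.
apply: ord_near_eq H; near=> t; apply/esym/s2; near: t; exact: near_Lhat_pos.
Unshelve. all: end_near. Qed.

(** The derivative is at most 1/t = exp(- L_1), and m >= 1 makes L_{m+1} negligible against L_1, so
    every order is reached. *)
Lemma ord_dLiter sig j : (0 < m)%N -> ord m sig (fun t => (@dLiter R j.+1 t)%:C).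
Proof.
move=> m0 s _; near=> t.
have t0 : 0 < t by near: t; apply: nbhs_pinfty_gt; exact: num_real.
have /andP[d0 d1] : 0 <= dLiter j.+1 t <= t^-1 by near: t; exact: near_dLiter.
have l0 : 0 < Liter m.+1 t by near: t; exact: near_Liter_gt.
rewrite normc_real ger0_norm// (le_trans d1)//.
rewrite -[t in t^-1]lnK ?posrE// -expRN ler_expR mulNr lerN2.
have s1 : 0 < `|s| + 1 by rewrite ltr_wpDl.
have h : Liter m.+1 t <= (`|s| + 1)^-1 * Liter 1 t.
  by near: t; apply: near_Liter_small; rewrite ?ltnS// invr_gt0.
apply: (@le_trans _ _ ((`|s| + 1) * Liter m.+1 t)).
  by rewrite ler_wpM2r ?(ltW l0)// (le_trans (ler_norm _))// lerDl.
by rewrite -ler_pdivlMl.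
Unshelve. all: end_near. Qed.

(** The part of the logarithmic derivative of a power that comes from alpha_0, ..., alpha_k. The
    exponent alpha_{-1} contributes itself, since ln e^t has derivative 1. *)
Definition log_rate k (a : 'rV[R[i]]_k.+2) (t : R) : R[i] :=
  \sum_(j < k.+1) a 0 (lift ord0 j) * (dLiter j.+1 t)%:C.

Lemma ord_log_rate sig k (a : 'rV[R[i]]_k.+2) : (0 < m)%N -> ord m sig (log_rate a).
Proof. by move=> m0; apply: ord_sum => j _; apply: ordMl; exact: ord_dLiter. Qed.

Lemma cderiv_vpow_Lhat k (a : 'rV[R[i]]_k.+2) : \forall t \near +oo,
  cderiv (fun s => vpow (Lhat k s) a) t ((a 0 ord0 + log_rate a t) * vpow (Lhat k t) a).
Proof.
near=> t.
rewrite (_ : (fun s => _) = fun s => cexp (\sum_(j < k.+2) a 0 j * (Liter j s)%:C)); last first.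
  by apply/funext => s; rewrite vpow_Lhat cexp_sum.
rewrite vpow_Lhat -cexp_sum; apply: cderiv_cexp.
have -> : a 0 ord0 + log_rate a t = \sum_(j < k.+2) a 0 j * (dLiter j t)%:C.
  by rewrite big_ord_recl /= /dLiter big_ord0 mulr1.
apply: cderiv_sum => j _; apply: cderivMl; apply: cderiv_real.
apply: is_derive_Liter => i ij.
have h : forall i, (i < k.+2)%N -> 0 < Liter i t by near: t; exact: near_Liter_gtn.
by apply: h; rewrite (ltn_trans ij).
Unshelve. all: end_near. Qed.

End PowersOfLogarithms.

(** * Z_A solves the linear equation up to negligible terms *)

Section OperatorZ.
Variables (R : realType) (n : nat) (A : 'M[R[i]]_n).
Hypothesis A_eig : forall a : R[i], eigenvalue A a -> 0 < complex.Re a.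
Variables (m k : nat) (mu : R) (p : 'rV[R]_k.+2 -> 'cV[R[i]]_n).
Hypotheses (m_gt0 : (0 < m)%N) (mk : (m <= k)%N) (p_cl : classP m mu p).

Lemma classP_opZ : classP m mu (opZ A p).
Proof.
have [S [xi [uS Scl Sp]]] := p_cl.
have rep : represents (-1) 0 S xi p.
  by split => // a /Scl; exact: expclassN1.
by rewrite (opZE _ rep); exists S; eexists; split => //.
Qed.

(** The coefficient eta_a = (A + alpha_{-1})^(-1) xi_a satisfies A eta_a + alpha_{-1} eta_a = xi_a,
    so differentiating the factor e^t alone produces exactly - A Z_A p + p. The [log_rate] terms
    form [r]. *)
Lemma has_derivative_opZ : exists2 r : R -> 'cV[R[i]]_n,
  (forall sig i, ord m sig (fun t => r t i 0)) &
  \forall t \near +oo, has_derivative (fun s => opZ A p (Lhat k s)) t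
    (- (A *m opZ A p (Lhat k t)) + p (Lhat k t) + r t).
Proof.
have [S [xi [uS Scl Sp]]] := p_cl.
have rep : represents (-1) 0 S xi p.
  by split => // a /Scl; exact: expclassN1.
rewrite (opZE _ rep).
pose eta (a : 'rV[R[i]]_k.+2) := invmx (A + (a 0 0)%:M) *m xi a.
have etaE a : a \in S -> xi a - A *m eta a = a 0 0 *: eta a.
  move=> /Scl/(_ ord0)[+ _] => /(_ isT) a0.
  rewrite -{1}[xi a](mulKVmx (shift_unitmx A_eig a0)) -/(eta a).
  by rewrite mulmxDl addrC addKr mul_scalar_mx.
exists (fun t => \sum_(a <- S) (log_rate a t * vpow (Lhat k t) a) *: eta a).
  move=> sig i.
  rewrite (_ : (fun t => _) = fun t => \sum_(a <- S | a \in S)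
      (log_rate a t * vpow (Lhat k t) a) * eta a i 0); last first.
    apply/funext => t; rewrite summxE -big_seq; apply: eq_bigr => a _.
    by rewrite mxE.
  apply: ord_sum => a /Scl aS.
  (* [log_rate] has every order; taking it at sig + mu offsets the order - mu of the power. *)
  rewrite -[sig](subrK (- mu)) -[_ + _]addr0; apply: ordM; last exact: ord_cst.
  by apply: ordM; [exact: ord_log_rate|exact: ord_vpow_Lhat].
have hS : \forall t \near +oo, forall a, a \in S ->
   cderiv (fun s => vpow (Lhat k s) a) t ((a 0 ord0 + log_rate a t) * vpow (Lhat k t) a).
  elim: (S) => [|b S' IH]; first by near=> t.
  near=> t => a; rewrite inE => /predU1P[->|].
    by near: t; exact: cderiv_vpow_Lhat.
  by move: a; near: t; exact: IH.
near=> t; apply/has_derivativeE => i.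
have ht : forall a, a \in S ->
   cderiv (fun s => vpow (Lhat k s) a) t ((a 0 ord0 + log_rate a t) * vpow (Lhat k t) a).
  by near: t.
have pt : positive_vec (Lhat k t) by near: t; exact: near_Lhat_pos.
rewrite (_ : (fun s => _) = fun s =>
    \sum_(a <- S | a \in S) vpow (Lhat k s) a * eta a i 0); last first.
  apply/funext => s; rewrite /power_sum summxE -big_seq.
  by apply: eq_bigr => a _; rewrite mxE.
have -> : (- (A *m power_sum S eta (Lhat k t)) + p (Lhat k t) +
    \sum_(a <- S) (log_rate a t * vpow (Lhat k t) a) *: eta a) i 0 =
  \sum_(a <- S | a \in S) ((a 0 ord0 + log_rate a t) * vpow (Lhat k t) a) * eta a i 0.
  rewrite Sp// /power_sum mulmx_sumr -sumrN -!big_split /= summxE -big_seq.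
  apply: eq_big_seq => a /etaE E.
  rewrite -scalemxAr -scalerN -scalerDr [- _ + _]addrC E !mxE; ring.
apply: cderiv_sum => a aS.
have := cderivM (ht a aS) (cderiv_cst (eta a i 0) t).
by rewrite mulr0 addr0.
Unshelve. all: end_near. Qed.

End OperatorZ.

(** * Solvability of the recursion for the q_k *)

Section Recursion.
Variables (R : realType) (n : nat) (A : 'M[R[i]]_n).
Variable GG : forall m : nat, ('I_m -> 'cV[R[i]]_n) -> 'cV[R[i]]_n.
Variables (mu : nat -> R) (nk : nat -> nat).
Hypotheses (mu_gt0 : forall k, 0 < mu k) (mu_incr : increasing_seq mu).
Local Notation qtype := (forall k, 'rV[R]_(nk k).+2 -> 'cV[R[i]]_n).
Implicit Types (q : qtype) (k : nat).

Lemma mu_lt i j : (mu i < mu j) = (i < j)%N.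
Proof. by rewrite !ltNge mu_incr -ltnNge. Qed.

(** Among at least two positive summands each one is strictly below the total. This makes the
    recursion triangular. *)
Lemma sum_mu_index_lt m (j : 'I_m -> nat) k (l : 'I_m) : (2 <= m)%N ->
  \sum_l mu (j l) = mu k -> (j l < k)%N.
Proof.
case: m j l => [|[|m]]// j l _ E; rewrite -mu_lt -E (bigD1 l)//= ltrDl.
have [l' ll'] : exists l', l' != l.
  by have [->|?] := eqVneq l ord0; [exists ord_max|exists ord0; rewrite eq_sym].
rewrite (bigD1 l')//= ltr_wpDr// sumr_ge0// => i _; exact: ltW.
Qed.

Lemma sum_mu_ge m (j : 'I_m -> nat) : m%:R * mu 0 <= \sum_l mu (j l).
Proof.
rewrite mulr_natl -[m in X in X <= _](card_ord m) -sumr_const.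
by apply: ler_sum => l _; rewrite mu_incr.
Qed.

(** [M] bounds the number of factors by [sum_mu_ge], and [K] bounds the indices by
    [sum_mu_index_lt]. Both are left free so that one range can serve all k <= N at once. *)
Lemma nonlinear_sumE q k (z : 'rV[R]_(nk k).+2) (M K : nat) : mu k <= M%:R * mu 0 -> (k <= K)%N ->
  nonlinear_sum GG mu q z = \sum_(2 <= m < M.+1)
    \sum_(j : {ffun 'I_m -> 'I_K.+1} | \sum_l mu (j l) == mu k)
      GG (fun l => q (j l) (restrict_vars (nk (j l)) z)).
Proof.
move=> kM kK; rewrite /nonlinear_sum (fsbigE (index_iota 2 M.+1)) ?iota_uniq//=; first last.
- move=> m m2; rewrite mem_index_iota m2 /= -leqNgt => Mm.
  apply: fsbig1 => j /= E; have := sum_mu_ge j; rewrite E => /le_trans/(_ kM).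
  by rewrite ler_pM2r ?mu_gt0// ler_nat leqNgt Mm.
- by move=> m /=; rewrite mem_index_iota => /andP[].
rewrite [LHS]big_seq_cond [RHS]big_seq; apply: eq_big => [m|m].
  apply/andP/idP => [[]//|mM]; split => //; rewrite in_setE /=.
  by move: mM; rewrite mem_index_iota => /andP[].
move=> /andP[_]; rewrite in_setE /= => m2.
pose h (j : {ffun 'I_m -> 'I_K.+1}) : {ffun 'I_m -> nat} := [ffun l => nat_of_ord (j l)].
rewrite (reindex_fsbig h [set j : {ffun 'I_m -> 'I_K.+1} | \sum_l mu (j l) = mu k]); last first.
  split.
  - by move=> j /= <-; apply: eq_bigr => l _; rewrite ffunE.
  - by move=> j j' _ _ /ffunP E; apply/ffunP => l; apply: val_inj; have := E l; rewrite !ffunE.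
  - move=> j /= E; have jK l : (j l < K.+1)%N.
      by rewrite ltnS (leq_trans _ kK)// ltnW// (sum_mu_index_lt _ m2 E).
    exists [ffun l => inord (j l)].
      by rewrite /= -E; apply: eq_bigr => l _; rewrite ffunE inordK.
    by apply/ffunP => l; rewrite !ffunE inordK.
rewrite (fsbigE [seq j : {ffun 'I_m -> 'I_K.+1} <- index_enum {ffun 'I_m -> 'I_K.+1} |
  \sum_l mu (j l) == mu k]); first last.
- by move=> j /= E; rewrite mem_filter mem_index_enum E eqxx.
- by move=> j /=; rewrite mem_filter => /andP[/eqP].
- by rewrite filter_uniq// index_enum_uniq.
rewrite big_filter_cond; apply: eq_big => [j|j _].
  apply/andP/idP => [[]//|E]; split => //; rewrite in_setE /=; exact/eqP.
by congr (GG _); apply/funext => l; rewrite ffunE.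
Qed.

Lemma nonlinear_sum_ext q q' k (z : 'rV[R]_(nk k).+2) :
  (forall j, (j < k)%N -> q j = q' j) ->
  nonlinear_sum GG mu q z = nonlinear_sum GG mu q' z.
Proof.
move=> qq'; apply: eq_fsbigr => m; rewrite in_setE => m2.
apply: eq_fsbigr => j; rewrite in_setE => /= E.
by congr (GG _); apply/funext => l; rewrite qq'// (sum_mu_index_lt _ m2 E).
Qed.

Variables (ms : nat) (p : qtype).
Hypotheses (ms_gt0 : (0 < ms)%N) (nk_ge : forall k, (ms <= nk k)%N)
  (nk_incr : forall k, (nk k <= nk k.+1)%N).
Hypothesis GG_lin : forall m, (2 <= m)%N -> multilinear_map (@GG m).
Hypothesis p_cl : forall k, classP ms (- mu k) (@p k).

Lemma nk_le i j : (i <= j)%N -> (nk i <= nk j)%N.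
Proof.
elim: j => [|j IH]; first by case: i.
by rewrite leq_eqVlt => /predU1P[->|/IH/leq_trans]//; apply.
Qed.

Definition recursion_rhs q : qtype := fun k z => nonlinear_sum GG mu q z + @p k z.

(** Component k depends only on the components below k, so iterating the recursion from 0 leaves it
    fixed after k + 1 rounds. The diagonal of the iterates is the solution. *)
Lemma recursion_solvable : exists q : qtype, forall k, q k = opZ A (@recursion_rhs q k).
Proof.
pose Q i : qtype := iter i (fun q k => opZ A (@recursion_rhs q k)) (fun k z => 0).
pose q : qtype := fun k => Q k.+1 k.
have rhs_ext q1 q2 k : (forall j, (j < k)%N -> q1 j = q2 j) ->
    recursion_rhs q1 (k := k) = recursion_rhs q2 (k := k).
  by move=> h; apply/funext => z; rewrite /recursion_rhs (nonlinear_sum_ext z h).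
have Qq k i : (k < i)%N -> Q i k = q k.
  elim/ltn_ind : k i => k IH [//|i]; rewrite ltnS => ki.
  rewrite /q /=; congr (opZ A); apply: rhs_ext => j jk.
  by rewrite IH ?(leq_trans jk)// -(IH j jk k jk).
exists q => k; rewrite {1}/q /=; congr (opZ A); apply: rhs_ext => j jk.
exact: Qq.
Qed.

(** The exponents of the factors add up to - mu k, and every factor can be read in the variables of
    index k because n_j <= n_k for j < k. *)
Lemma classP_recursion_rhs q k : (forall j, (j < k)%N -> classP ms (- mu j) (q j)) ->
  classP ms (- mu k) (@recursion_rhs q k).
Proof.
move=> hq; apply/classP_psum => i.
have [M kM] : exists M : nat, mu k <= M%:R * mu 0.
  exists (Num.truncn (mu k / mu 0)).+1.
  by rewrite -ler_pdivrMr// ltW// truncnS_gt.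
pose F (z : 'rV[R]_(nk k).+2) : R[i] := \sum_(m <- index_iota 2 M.+1 | (2 <= m)%N)
    \sum_(j : {ffun 'I_m -> 'I_k.+1} | \sum_l mu (j l) == mu k)
      GG (fun l => q (j l) (restrict_vars (nk (j l)) z)) i 0.
have hF : psum ms (- mu k) F.
  apply: psum_sum => m m2; apply: psum_sum => j /eqP E.
  rewrite -E -sumrN; apply: psum_multilinear; first exact: GG_lin.
  move=> l i'; have jk := sum_mu_index_lt l m2 E.
  apply: (psum_restrict (p := fun w => q (j l) w i' 0)) => //; first by rewrite nk_le// ltnW.
  by move: i'; apply/classP_psum; exact: hq.
apply: psum_ext (psumD hF (proj1 (classP_psum _ _ _) (p_cl k) i)) => z _.
rewrite /recursion_rhs [RHS]mxE (nonlinear_sumE _ _ kM (leqnn k)); congr (_ + _).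
rewrite /F summxE [in RHS]big_seq [in LHS]big_seq_cond; apply: eq_big => m.
  by rewrite mem_index_iota; case: leqP; rewrite ?andbF ?andbT.
by move=> _; rewrite summxE.
Qed.

Lemma classP_recursion q : (forall k, q k = opZ A (@recursion_rhs q k)) ->
  forall k, classP ms (- mu k) (q k).
Proof.
move=> hq; elim/ltn_ind => k IH; rewrite hq.
by apply: classP_opZ; exact: classP_recursion_rhs.
Qed.

End Recursion.

(** * Decay orders of vector-valued functions *)

Section VectorOrder.
Variables (R : realType) (n m : nat).
Implicit Types (u v : R -> 'cV[R[i]]_n) (sig s mu : R).
Local Notation ell := (@Liter R m.+1).

Definition vord sig u : Prop := forall i, ord m sig (fun t => u t i 0).

Lemma vord_le sig sig' u : sig' <= sig -> vord sig u -> vord sig' u.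
Proof. by move=> ss h i; exact: ord_le (h i). Qed.

Lemma vord_near_eq sig u v :
  (\forall t \near +oo, u t = v t) -> vord sig u -> vord sig v.
Proof.
move=> uv h i; apply: ord_near_eq (h i); near=> t.
by rewrite (near uv t).
Unshelve. all: end_near. Qed.

Lemma vord_zero sig : vord sig (fun=> 0).
Proof. by move=> i; under eq_fun do rewrite mxE; exact: ord_zero. Qed.

Lemma vordD sig u v : vord sig u -> vord sig v -> vord sig (fun t => u t + v t).
Proof.
by move=> hu hv i; under eq_fun do rewrite mxE; apply: ordD.
Qed.

Lemma vordN sig u : vord sig u -> vord sig (fun t => - u t).
Proof. by move=> hu i; under eq_fun do rewrite mxE; apply: ordN. Qed.

Lemma vord_multilinear d (g : ('I_d -> 'cV[R[i]]_n) -> 'cV[R[i]]_n)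
    (sig : 'I_d -> R) (u : 'I_d -> R -> 'cV[R[i]]_n) :
  multilinear_map g -> (forall l, vord (sig l) (u l)) ->
  vord (\sum_l sig l) (fun t => g (fun l => u l t)).
Proof.
move=> gl hu i.
rewrite (_ : (fun t => _) = fun t => \sum_(j : {ffun 'I_d -> 'I_n})
     (\prod_l u l t (j l) 0) * g (fun l => delta_mx (j l) 0) i 0); last first.
  by apply/funext => t; rewrite [LHS]multilinear_coord.
apply: ord_sum => j _; rewrite -[\sum_l sig l]addr0; apply: ordM; last exact: ord_cst.
by apply: ord_prod => l; exact: hu.
Qed.

Lemma vord_enorm sig u s : vord sig u -> s < sig ->
  \forall t \near +oo, enorm (u t) <= expR (- s * ell t).
Proof.
move=> hu ss.
have h : ord m sig (fun t => \sum_(i < n) (normc (u t i 0))%:C).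
  apply: ord_sum => i _ s' ss'; near=> t.
  rewrite normc_real ger0_norm ?normc_ge0//; near: t; exact: hu.
near=> t; apply: (le_trans (enorm_le_sum _)).
have : normc (\sum_(i < n) (normc (u t i 0))%:C) <= expR (- s * ell t) by near: t; exact: h.
rewrite -rmorph_sum normc_real ger0_norm// sumr_ge0// => i _.
exact: normc_ge0.
Unshelve. all: end_near. Qed.

Lemma Liter_powR s : \forall t \near +oo, Liter m t `^ (- s) = expR (- s * ell t).
Proof.
near=> t; have l0 : 0 < Liter m t by near: t; exact: near_Liter_gt.
by rewrite /powR gt_eqF.
Unshelve. all: end_near. Qed.

Lemma bigO_vord s u : bigO_infty u (fun t => Liter m t `^ (- s)) -> vord s u.
Proof.
move=> [T [C [T0 C0 h]]] i s' ss'; near=> t.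
have Tt : T <= t by near: t; apply: nbhs_pinfty_ge; exact: num_real.
apply: (le_trans (normc_le_enorm _ _)); apply: (le_trans (h t Tt)).
by rewrite (near (Liter_powR s) t)//; near: t; exact: near_absorb.
Unshelve. all: end_near. Qed.

Lemma vord_bigO sig s u : vord sig u -> s < sig ->
  bigO_infty u (fun t => Liter m t `^ (- s)).
Proof.
move=> hu ss.
have : \forall t \near +oo, enorm (u t) <= 1 * Liter m t `^ (- s).
  near=> t; rewrite (near (Liter_powR s) t)// mul1r; near: t; exact: (vord_enorm hu).
move=> [T [_ hT]]; exists (`|T| + 1), 1; split => // t Tt.
by apply: hT; rewrite (lt_le_trans _ Tt)// (le_lt_trans (ler_norm T))// ltrDl.
Unshelve. all: end_near. Qed.

(** This matches the remainder condition of an asymptotic expansion, where some exponent beyond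
    gamma_N is required. It survives finite sums, by taking the minimum of the orders. *)
Definition vordgt mu u : Prop := exists2 sig, mu < sig & vord sig u.

Lemma vordgt_near_eq mu u v :
  (\forall t \near +oo, u t = v t) -> vordgt mu u -> vordgt mu v.
Proof. by move=> uv [sig ms hu]; exists sig => //; exact: vord_near_eq hu. Qed.

Lemma vordgtD mu u v : vordgt mu u -> vordgt mu v -> vordgt mu (fun t => u t + v t).
Proof.
move=> [s1 h1 hu] [s2 h2 hv]; exists (Num.min s1 s2); first by rewrite lt_min h1.
by apply: vordD; [apply: vord_le hu|apply: vord_le hv]; rewrite ge_min lexx ?orbT.
Qed.

Lemma vordgt_sum mu (I : Type) (r : seq I) (P : pred I) (F : I -> R -> 'cV[R[i]]_n) :
  (forall i, P i -> vordgt mu (F i)) ->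
  vordgt mu (fun t => \sum_(i <- r | P i) F i t).
Proof.
move=> h; elim: r => [|i r IH].
  exists (mu + 1); first by rewrite ltrDl.
  by under eq_fun do rewrite big_nil; exact: vord_zero.
under eq_fun do rewrite big_cons; case: (boolP (P i)) => // Pi.
by apply: vordgtD => //; exact: h.
Qed.

End VectorOrder.

(** * Estimates for the nonlinearity near the origin *)

Section Nonlinearity.
Variables (R : realType) (n : nat).
Local Notation V := 'cV[R[i]]_n.
Variables (G : V -> V) (Gm : nat -> V -> V)
  (GG : forall m : nat, ('I_m -> V) -> V).
Hypothesis G_adm : admissible_nonlinearity G Gm GG.

Lemma sqr_enormD (x y : V) : enorm (x + y) ^+ 2 <= 2 * enorm x ^+ 2 + 2 * enorm y ^+ 2.
Proof.
rewrite !sqr_enorm !mulr_sumr -big_split; apply: ler_sum => i _ /=.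
rewrite mxE; have := ler_normcD (x i 0) (y i 0).
move: (normc_ge0 (x i 0 + y i 0)) (normc_ge0 (x i 0)) (normc_ge0 (y i 0)).
move: (normc (x i 0 + y i 0)) (normc (x i 0)) (normc (y i 0)) => a b c a0 b0 c0 abc.
have : a ^+ 2 <= (b + c) ^+ 2 by rewrite ler_pXn2r// nnegrE addr_ge0.
have := sqr_ge0 (b - c); rewrite sqrrB sqrrD; lra.
Qed.

Lemma multilinear_bound d (g : ('I_d -> V) -> V) : multilinear_map g ->
  exists2 C : R, 0 <= C & forall x, enorm (g (fun=> x)) <= C * enorm x ^+ d.
Proof.
move=> gl; exists (\sum_(i < n) \sum_(j : {ffun 'I_d -> 'I_n})
    normc (g (fun l => delta_mx (j l) 0) i 0)).
  by apply: sumr_ge0 => i _; apply: sumr_ge0 => j _; exact: normc_ge0.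
move=> x; apply: (le_trans (enorm_le_sum _)); rewrite mulr_suml.
apply: ler_sum => i _; rewrite multilinear_coord// mulr_suml.
apply: (le_trans (ler_normc_sum _ _ _)); apply: ler_sum => j _.
rewrite normcM mulrC ler_wpM2l ?normc_ge0// normc_prod.
rewrite -[d in X in _ <= X](card_ord d) -prodr_const.
by apply: ler_prod => l _; rewrite normc_ge0 normc_le_enorm.
Qed.

(** The expansion truncated at degree 2 gives |G(x)|^2 <= K |x|^4 near 0, and two of the factors |x|
    are used to make the constant small. *)
Lemma G_sublinear (eta : R) : 0 < eta ->
  exists2 rho : R, 0 < rho & forall x, enorm x < rho -> enorm (G x) ^+ 2 <= eta * enorm x ^+ 2.
Proof.
move=> eta0; have [_ _ G_exp G_lin] := G_adm.
have [delta d0 [r [C [r0 C0 hC]]]] := G_exp 2%N isT.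
have [gl GE] := G_lin 2%N isT; have [C' C'0 hC'] := multilinear_bound gl.
(* The contributions of G - G_2 and of G_2, each doubled by [sqr_enormD]; the 1 keeps [K]
   positive. *)
pose K := 2 * C ^+ 2 + 2 * C' ^+ 2 + 1.
have K0 : 0 < K by rewrite ltr_wpDl// addr_ge0// mulr_ge0// sqr_ge0.
exists (Num.min r (Num.min 1 (eta / K))).
  by rewrite !lt_min r0 ltr01 divr_gt0.
move=> x; rewrite !lt_min => /and3P[xr x1 xe].
have := hC x xr; rewrite big_nat1 GE => h1.
have h2 := hC' x.
have e0 := enorm_ge0 x; move: (enorm x) e0 xr x1 xe h1 h2 => e e0 xr x1 xe h1 h2.
have h3 : e `^ (2%:R + delta) <= e ^+ 2.
  have [->|ne0] := eqVneq e 0; first by rewrite powR0 ?expr0n// gt_eqF// ltr_wpDl.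
  rewrite powRD ?ne0 ?implybT// powR_mulrn// ler_piMr ?exprn_ge0//.
  apply: (@le_trans _ _ (1 `^ delta)); last by rewrite powR1.
  by apply: ge0_ler_powR; rewrite ?nnegrE ?(ltW d0) ?(ltW x1).
have h4 : enorm (G x - GG (fun _ : 'I_2 => x)) ^+ 2 <= (C * e ^+ 2) ^+ 2.
  apply: lerXn2r; rewrite ?nnegrE ?enorm_ge0 ?mulr_ge0 ?exprn_ge0 ?(ltW C0)//.
  by rewrite (le_trans h1)// ler_wpM2l// ltW.
have h5 : enorm (GG (fun _ : 'I_2 => x)) ^+ 2 <= (C' * e ^+ 2) ^+ 2.
  by apply: lerXn2r; rewrite ?nnegrE ?enorm_ge0 ?mulr_ge0 ?exprn_ge0.
have := sqr_enormD (G x - GG (fun _ : 'I_2 => x)) (GG (fun _ : 'I_2 => x)); rewrite subrK => h6.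
apply: (@le_trans _ _ (K * e * e ^+ 2)); last first.
  by rewrite ler_wpM2r ?exprn_ge0// mulrC -ler_pdivlMr// ltW.
apply: (@le_trans _ _ (K * (e * e) * e ^+ 2)); last first.
  by rewrite ler_wpM2r ?exprn_ge0// ler_wpM2l ?(ltW K0)// ler_piMr// ltW.
have h7 : 0 <= e * e * e ^+ 2 by rewrite !mulr_ge0 ?exprn_ge0.
apply: (le_trans h6); rewrite /K; move: h4 h5 h7.
have Esq (c : R) : (c * e ^+ 2) ^+ 2 = c ^+ 2 * (e * e * e ^+ 2) by ring.
rewrite !Esq -[X in _ -> _ -> _ -> _ <= X]mulrA.
move: (e * e * e ^+ 2) => E h4 h5 h7; lra.
Qed.

(** The remainder is O(|y|^(M + delta)), and delta > 0 pushes its order strictly beyond M mu0. *)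
Lemma vord_G_remainder m (mu0 : R) (y : R -> V) (M : nat) : 0 < mu0 -> (2 <= M)%N ->
  vord m mu0 y ->
  vordgt m (M%:R * mu0) (fun t => G (y t) - \sum_(2 <= m < M.+1) GG (fun _ : 'I_m => y t)).
Proof.
move=> mu00 M2 hy; have [_ _ G_exp G_lin] := G_adm.
have [delta d0 [r [C [r0 C0 hC]]]] := G_exp M M2.
have Md : 0 < M%:R + delta by rewrite ltr_wpDl.
exists ((M%:R + delta) * mu0); first by rewrite ltr_pM2r// ltrDl.
move=> i s ss.
have ss' : s / (M%:R + delta) < mu0 by rewrite ltr_pdivrMr// mulrC.
(* [s'] lies strictly between s / (M + delta) and mu0: the first gap absorbs [C], the second makes
   the bound exp(- s' ell) on |y| available. *)
have [s1 s2] := midf_lt ss'; set s' := (_ + mu0) / 2 in s1 s2.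
have {s1}s1 : s < s' * (M%:R + delta) by rewrite -ltr_pdivrMr.
have hr : \forall t \near +oo, enorm (y t) < r.
  near=> t.
  have h1 : enorm (y t) <= expR (- (mu0 / 2) * Liter m.+1 t).
    by near: t; apply: (vord_enorm hy); lra.
  apply: (le_lt_trans h1); rewrite -[r]lnK ?posrE// ltr_expR mulNr ltrNl.
  rewrite mulrC -ltr_pdivrMr ?divr_gt0//; near: t; exact: near_Liter_gt.
near=> t; apply: (le_trans (normc_le_enorm _ _)).
have yr : enorm (y t) < r by near: t.
have := hC (y t) yr.
rewrite (eq_big_nat _ _ (F2 := fun m => GG (fun _ : 'I_m => y t))); last first.
  by move=> k /andP[k2 _]; rewrite (proj2 (G_lin k k2)).
move=> /le_trans; apply.
apply: (@le_trans _ _ (C * expR (- (s' * (M%:R + delta)) * Liter m.+1 t))); last first.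
  by near: t; exact: near_absorb.
rewrite ler_wpM2l ?(ltW C0)//.
have -> : - (s' * (M%:R + delta)) * Liter m.+1 t = (- s' * Liter m.+1 t) * (M%:R + delta).
  by ring.
rewrite expRM; apply: ge0_ler_powR; rewrite ?nnegrE ?enorm_ge0 ?expR_ge0 ?(ltW Md)//.
near: t; exact: (vord_enorm hy).
Unshelve. all: end_near. Qed.

End Nonlinearity.

(** * Asymptotic expansion of the solution *)

Section Expansion.
Variables (R : realType) (n : nat) (A : 'M[R[i]]_n).
Hypothesis n_gt0 : (0 < n)%N.
Hypothesis A_eig : forall a : R[i], eigenvalue A a -> 0 < complex.Re a.
Local Notation V := 'cV[R[i]]_n.
Variables (G : V -> V) (Gm : nat -> V -> V) (GG : forall m : nat, ('I_m -> V) -> V).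
Hypothesis G_adm : admissible_nonlinearity G Gm GG.
Variables (f : R -> V) (ms : nat).
Hypothesis ms_gt0 : (0 < ms)%N.
Variable mu : nat -> R.
Hypotheses (mu_gt0 : forall k, 0 < mu k) (mu_incr : increasing_seq mu).
Hypothesis mu_add : forall x y : R, range mu x -> range mu y -> range mu (x + y).
Variable nk : nat -> nat.
Hypotheses (nk_ge : forall k, (ms <= nk k)%N) (nk_incr : forall k, (nk k <= nk k.+1)%N).
Variable fk : nat -> R -> V.
Hypothesis f_exp : asymptotic_expansion ms mu nk f fk.
Variables (T0 : R) (y : R -> V).
Hypothesis y_sol : forall t, T0 < t ->
  has_derivative y t (- (A *m y t) + G (y t) + f t).
Hypothesis y_to0 : enorm (y t) @[t --> +oo] --> (0 : R).
Variable p : forall k, 'rV[R]_(nk k).+2 -> V.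
Hypothesis p_cl : forall k, classP ms (- mu k) (@p k).
Hypothesis fkE : forall k t, Eiter (nk k) 0 < t -> fk k t = p (Lhat (nk k) t).
Variable q : forall k, 'rV[R]_(nk k).+2 -> V.
Hypothesis qE : forall k, @q k = opZ A (@recursion_rhs _ _ GG mu nk p (fun k => @q k) k).

Let GG_lin m : (2 <= m)%N -> multilinear_map (@GG m).
Proof. by case: G_adm => _ _ _ /(_ m) h /h[]. Qed.

Let q_cl k : classP ms (- mu k) (@q k).
Proof. exact: (classP_recursion mu_gt0 mu_incr nk_ge nk_incr GG_lin p_cl qE k). Qed.

Let Y k (t : R) : V := q (Lhat (nk k) t).

Lemma vord_Y k : vord ms (mu k) (Y k).
Proof.
move=> i; rewrite -[mu k]opprK.
by apply: (psum_ord (p := fun z => @q k z i 0)) => //;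
  exact: (proj1 (classP_psum _ _ _) (q_cl k) i).
Qed.

Lemma vord_fk k : vord ms (mu k) (fk k).
Proof.
apply: (@vord_near_eq _ _ _ _ (fun t => p (Lhat (nk k) t))).
  near=> t; rewrite fkE//; near: t; apply: nbhs_pinfty_gt; exact: num_real.
move=> i; rewrite -[mu k]opprK.
by apply: (psum_ord (p := fun z => @p k z i 0)) => //;
  exact: (proj1 (classP_psum _ _ _) (p_cl k) i).
Unshelve. all: end_near. Qed.

Lemma vordgt_f N : vordgt ms (mu N) (fun t => f t - \sum_(k < N.+1) fk k t).
Proof.
have [_ /(_ N) [s ms' h]] := f_exp; exists s => //; exact: bigO_vord.
Qed.

Lemma near_y_sol : \forall t \near +oo, has_derivative y t (- (A *m y t) + G (y t) + f t).
Proof.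
near=> t; apply: y_sol; near: t; apply: nbhs_pinfty_gt; exact: num_real.
Unshelve. all: end_near. Qed.

(** Near 0, |G(y)|^2 <= (eps / 2) |y|^2, so by [sqr_enormD] the nonlinearity fits into the tolerance
    of [stable_ord], and only [f], of order [mu 0], determines the decay. *)
Lemma vord_y : vord ms (mu 0) y.
Proof.
have [eps eps0 stable] := stable_ord n_gt0 A_eig ms.
have f0 : vord ms (mu 0) f.
  have [s s0 hs] := vordgt_f 0.
  apply: (@vord_near_eq _ _ _ _ (fun t => (f t - \sum_(k < 1) fk k t) + fk 0 t)).
    by near=> t; rewrite big_ord1 subrK.
  by apply: vordD; [exact: vord_le (ltW s0) hs|exact: vord_fk].
apply: (stable _ _ (fun t => G (y t) + f t)).
  by near=> t; rewrite addrA; near: t; exact: near_y_sol.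
move=> s ss.
have [s1 s2] := midf_lt ss; set s' := (s + mu 0) / 2 in s1 s2.
have e20 : 0 < eps / 2 by rewrite divr_gt0.
have [rho rho0 hrho] := G_sublinear G_adm e20.
near=> t.
have yr : enorm (y t) < rho.
  near: t; have /cvgrPdist_lt/(_ _ rho0) := y_to0.
  apply: filterS => t; rewrite sub0r normrN ger0_norm//; exact: enorm_ge0.
have h1 := hrho _ yr.
have h2 : enorm (f t) <= expR (- s' * Liter ms.+1 t) by near: t; exact: (vord_enorm f0).
have h3 : enorm (f t) ^+ 2 <= expR (- (2 * s') * Liter ms.+1 t).
  have -> : - (2 * s') * Liter ms.+1 t = 2%:R * (- s' * Liter ms.+1 t) by ring.
  by rewrite expRM_natl lerXn2r ?nnegrE ?enorm_ge0 ?expR_ge0.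
have h4 : 2 * expR (- (2 * s') * Liter ms.+1 t) <= expR (- (2 * s) * Liter ms.+1 t).
  by near: t; apply: near_absorb; lra.
have := sqr_enormD (G (y t)) (f t); lra.
Unshelve. all: end_near. Qed.

Let Rem N (t : R) : V := y t - \sum_(k < N) Y k t.

Lemma mu_le i j : (mu i <= mu j) = (i <= j)%N. Proof. exact: mu_incr. Qed.

Lemma sum_mu_range m (j : 'I_m.+1 -> nat) : range mu (\sum_l mu (j l)).
Proof.
elim: m j => [|m IH] j; first by rewrite big_ord1; exists (j 0).
by rewrite big_ord_recl; apply: mu_add; [exists (j ord0)|exact: IH].
Qed.

(** Index N stands for the remainder, of order [theta]. If it does not occur, the sum lies in the
    range of [mu] and, being none of mu 0, ..., mu N, exceeds mu N. If it occurs, another factor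
    adds at least mu 0 to theta. *)
Lemma sum_order_gt N (theta : R) m (j : 'I_m -> 'I_N.+1) : (2 <= m)%N ->
  mu 0 <= theta -> mu N < theta + mu 0 ->
  (forall k : 'I_N.+1, \sum_l mu (j l) != mu k) ->
  mu N < \sum_l (if (j l < N)%N then mu (j l) else theta).
Proof.
move=> m2 th0 thN bad.
have [jN|] := pselect (forall l, (j l < N)%N).
  under eq_bigr do rewrite jN.
  case: m m2 j bad jN => // m _ j bad jN.
  have [k _ E] := sum_mu_range (fun l => j l); rewrite -E mu_lt// ltnNge.
  apply/negP => kN; have kN' : (k < N.+1)%N by rewrite ltnS.
  by have := bad (Ordinal kN'); rewrite -E /= eqxx.
move=> /existsNP[l /negP jl].
have ge0 i : mu 0 <= (if (j i < N)%N then mu (j i) else theta).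
  by case: ifP => // _; rewrite mu_le.
have [l' ll'] : exists l', l' != l.
  case: m m2 j l {bad jl ge0} => [|[|m]]// _ j l.
  by have [->|?] := eqVneq l ord0; [exists ord_max|exists ord0; rewrite eq_sym].
rewrite (bigD1 l)//= (negbTE jl) (lt_le_trans thN)// lerD2l (bigD1 l')//=.
rewrite (le_trans (ge0 l'))// lerDl sumr_ge0// => i _.
by rewrite (le_trans _ (ge0 i))// ltW.
Qed.

Lemma GG_remainder N (theta : R) m : (2 <= m)%N ->
  mu 0 <= theta -> mu N < theta + mu 0 -> vord ms theta (Rem N) ->
  vordgt ms (mu N) (fun t => GG (fun _ : 'I_m => y t) -
    \sum_(k < N.+1) \sum_(j : {ffun 'I_m -> 'I_N.+1} | \sum_l mu (j l) == mu k)
      GG (fun l => Y (j l) t)).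
Proof.
move=> m2 th0 thN hR.
(* [u] lists the terms [Y k] for k < N and puts the remainder at index N, so that y is the sum of
   all [u k]. *)
pose u (k : 'I_N.+1) t := if (k < N)%N then Y k t else Rem N t.
pose sg (k : 'I_N.+1) := if (k < N)%N then mu k else theta.
have hu k : vord ms (sg k) (u k).
  by rewrite /sg /u; case: ifP => _ //; exact: vord_Y.
(* A good tuple sums to some mu k with k <= N. Its indices are then below k, so the remainder does
   not occur in its product. *)
pose good (j : {ffun 'I_m -> 'I_N.+1}) := [exists k : 'I_N.+1, \sum_l mu (j l) == mu k].
have H : vordgt ms (mu N) (fun t =>
    \sum_(j : {ffun 'I_m -> 'I_N.+1} | ~~ good j) GG (fun l => u (j l) t)).
  apply: vordgt_sum => j /existsPn bad.
  exists (\sum_l sg (j l)); first exact: sum_order_gt.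
  by apply: (vord_multilinear (u := fun l => u (j l))) => //; exact: GG_lin.
apply: vordgt_near_eq H; near=> t.
have yE : y t = \sum_(k < N.+1) 1 *: u k t.
  rewrite big_ord_recr /= !scale1r /u ltnn /Rem.
  rewrite (eq_bigr (fun k : 'I_N => Y k t)); last by move=> k _; rewrite scale1r /= ltn_ord.
  by rewrite addrC subrK.
have -> : GG (fun _ : 'I_m => y t) = \sum_(j : {ffun 'I_m -> 'I_N.+1}) GG (fun l => u (j l) t).
  rewrite yE (multilinear_expand (fun _ _ => 1) (fun k => u k t) (GG_lin m2)).
  by apply: eq_bigr => j _; rewrite big1// scale1r.
suff -> : \sum_(k < N.+1) \sum_(j : {ffun 'I_m -> 'I_N.+1} | \sum_l mu (j l) == mu k)
    GG (fun l => Y (j l) t) = \sum_(j | good j) GG (fun l => u (j l) t).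
  by rewrite [X in _ = X - _](bigID good) /= addrAC subrr add0r.
rewrite (exchange_big_dep good) /=; last by move=> k j _ E; apply/existsP; exists k.
apply: eq_bigr => j /existsP[k0 /eqP E0].
rewrite (big_pred1 k0) => [|k]; last first.
  by rewrite /= E0 (inj_eq (inc_inj mu_incr)) eq_sym.
congr (GG _); apply/funext => l; rewrite /u ifT//.
by rewrite (leq_trans (sum_mu_index_lt mu_gt0 mu_incr (j := fun l => j l) l m2 E0))// -ltnS.
Unshelve. all: end_near. Qed.

(** One application of [has_derivative_opZ] per term, with the errors accumulated in [r]. *)
Lemma near_has_derivative_sum_Y N : exists2 r : R -> V,
  forall sig, vord ms sig r &
  \forall t \near +oo, has_derivative (fun s => \sum_(k < N) Y k s) t
    (- (A *m \sum_(k < N) Y k t) +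
     \sum_(k < N) (nonlinear_sum GG mu (fun k => @q k) (Lhat (nk k) t) + fk k t) + r t).
Proof.
elim: N => [|N [r hr IH]].
  exists (fun=> 0) => [sig|]; first exact: vord_zero.
  near=> t; rewrite !big_ord0 mulmx0 oppr0 !addr0; apply/has_derivativeE => i.
  rewrite mxE (_ : (fun s => _) = fun=> 0); first exact: cderiv_cst.
  by apply/funext => s; rewrite big_ord0 mxE.
have rhs_cl := classP_recursion_rhs mu_gt0 mu_incr nk_ge nk_incr GG_lin p_cl
  (fun j (_ : (j < N)%N) => q_cl j).
have [r' hr' dY] := has_derivative_opZ A_eig ms_gt0 (nk_ge N) rhs_cl.
exists (fun t => r t + r' t) => [sig|].
  by apply: vordD => // i; exact: hr'.
near=> t.
have h1 : has_derivative (fun s => \sum_(k < N) Y k s) t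
    (- (A *m \sum_(k < N) Y k t) +
     \sum_(k < N) (nonlinear_sum GG mu (fun k => @q k) (Lhat (nk k) t) + fk k t) + r t).
  by near: t.
have h2 : has_derivative (Y N) t (- (A *m Y N t) +
    (nonlinear_sum GG mu (fun k => @q k) (Lhat (nk N) t) + fk N t) + r' t).
  rewrite fkE; last by near: t; apply: nbhs_pinfty_gt; exact: num_real.
  by rewrite /Y qE; near: t; exact: dY.
rewrite (_ : (fun s => _) = fun s => \sum_(k < N) Y k s + Y N s); last first.
  by apply/funext => s; rewrite big_ord_recr.
rewrite !big_ord_recr /= mulmxDr opprD [X in has_derivative _ _ (X + _)]addrACA.
rewrite [X in has_derivative _ _ X]addrACA.
exact: has_derivativeD h1 h2.
Unshelve. all: end_near. Qed.

(** The next remainder solves the linear equation with a forcing [g] of order beyond mu N, and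
    [stable_ord] transfers this order from [g] to it. *)
Lemma Rem_step N (theta : R) : mu 0 <= theta -> mu N < theta + mu 0 ->
  vord ms theta (Rem N) -> vordgt ms (mu N) (Rem N.+1).
Proof.
move=> th0 thN hR.
have [eps eps0 stable] := stable_ord n_gt0 A_eig ms.
have [r hr dY] := near_has_derivative_sum_Y N.+1.
(* The offset 2 ensures both 2 <= M and mu N <= M mu 0. *)
pose M := (Num.truncn (mu N / mu 0)).+2.
have NM : mu N <= M%:R * mu 0.
  rewrite -ler_pdivrMr// ltW// (lt_le_trans (truncnS_gt _))//.
  by rewrite ler_nat.
pose g t := G (y t) + f t - (\sum_(k < N.+1)
   (nonlinear_sum GG mu (fun k => @q k) (Lhat (nk k) t) + fk k t) + r t).
have [sig sigN hg] : vordgt ms (mu N) g.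
  (* [g] splits into the truncation error of G, that of f, the multilinear errors of each degree,
     and - r. *)
  have H1 : vordgt ms (mu N) (fun t => G (y t) - \sum_(2 <= m < M.+1) GG (fun _ : 'I_m => y t)).
    have [s h1 h2] := vord_G_remainder G_adm (mu_gt0 0) (isT : (2 <= M)%N) vord_y.
    by exists s => //; exact: le_lt_trans h1.
  have H2 := vordgt_f N.
  have H3 : vordgt ms (mu N) (fun t => \sum_(m <- index_iota 2 M.+1 | (2 <= m)%N)
      (GG (fun _ : 'I_m => y t) -
      \sum_(k < N.+1) \sum_(j : {ffun 'I_m -> 'I_N.+1} | \sum_l mu (j l) == mu k)
        GG (fun l => Y (j l) t))).
    by apply: vordgt_sum => m m2; exact: GG_remainder hR.
  have H4 : vordgt ms (mu N) (fun t => - r t).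
    by exists (mu N + 1); [rewrite ltrDl|apply: vordN; exact: hr].
  apply: vordgt_near_eq (vordgtD (vordgtD (vordgtD H1 H2) H3) H4).
  near=> t; rewrite /g.
  have -> : \sum_(k < N.+1) (nonlinear_sum GG mu (fun k => @q k) (Lhat (nk k) t) + fk k t) =
    \sum_(2 <= m < M.+1) \sum_(k < N.+1)
      \sum_(j : {ffun 'I_m -> 'I_N.+1} | \sum_l mu (j l) == mu k) GG (fun l => Y (j l) t) +
    \sum_(k < N.+1) fk k t.
    rewrite big_split /=; congr (_ + _); rewrite exchange_big /=; apply: eq_bigr => k _.
    have kN : (k <= N)%N by rewrite -ltnS.
    (* The bounds M and N serve every k <= N, as the exchange of the sums over k and over the degree
       requires. *)
    rewrite (@nonlinear_sumE _ _ _ _ _ mu_gt0 mu_incr _ _ _ M N)//; last first.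
      by rewrite (le_trans _ NM)// mu_le.
    rewrite [LHS]big_nat_cond [RHS]big_nat_cond; apply: eq_bigr => m /andP[/andP[m2 _] _].
    apply: eq_bigr => j /eqP E; congr (GG _); apply/funext => l.
    have jk := sum_mu_index_lt mu_gt0 mu_incr (j := fun l => j l) l m2 E.
    by rewrite restrict_Lhat// (nk_le nk_incr)// ltnW.
  have -> : \sum_(m <- index_iota 2 M.+1 | (2 <= m)%N)
      (GG (fun _ : 'I_m => y t) -
      \sum_(k < N.+1) \sum_(j : {ffun 'I_m -> 'I_N.+1} | \sum_l mu (j l) == mu k)
        GG (fun l => Y (j l) t)) = \sum_(2 <= m < M.+1) GG (fun _ : 'I_m => y t) -
     \sum_(2 <= m < M.+1) \sum_(k < N.+1)
      \sum_(j : {ffun 'I_m -> 'I_N.+1} | \sum_l mu (j l) == mu k) GG (fun l => Y (j l) t).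
    rewrite -sumrB [LHS]big_seq_cond [RHS]big_seq; apply: eq_bigl => m.
    by rewrite mem_index_iota; case: (leqP 2 m); rewrite ?andbT ?andbF.
  move: (\sum_(2 <= m < M.+1) _) (\sum_(2 <= m < M.+1) _) => a b.
  by apply/matrixP => i j; rewrite !mxE; ring.
exists sig => //; apply: (stable _ _ g) => [|s ss].
  near=> t.
  have h1 : has_derivative y t (- (A *m y t) + G (y t) + f t).
    by near: t; exact: near_y_sol.
  have h2 : has_derivative (fun s => \sum_(k < N.+1) Y k s) t
      (- (A *m \sum_(k < N.+1) Y k t) + \sum_(k < N.+1)
        (nonlinear_sum GG mu (fun k => @q k) (Lhat (nk k) t) + fk k t) + r t).
    by near: t.
  have -> : - (A *m Rem N.+1 t) + g t = - (A *m y t) + G (y t) + f t -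
      (- (A *m \sum_(k < N.+1) Y k t) + \sum_(k < N.+1)
        (nonlinear_sum GG mu (fun k => @q k) (Lhat (nk k) t) + fk k t) + r t).
    rewrite /g /Rem mulmxBr.
    by apply/matrixP => i j; rewrite !mxE; ring.
  exact: has_derivativeD h1 (has_derivativeN h2).
(* Here [g] is bounded outright, so the tolerance term is merely added as a nonnegative quantity. *)
near=> t; rewrite (le_trans (y := expR (- (2 * s) * Liter ms.+1 t)))//; last first.
  by rewrite lerDr mulr_ge0 ?sqr_ge0 ?(ltW eps0).
have h2 : enorm (g t) <= expR (- s * Liter ms.+1 t) by near: t; exact: (vord_enorm hg).
have -> : - (2 * s) * Liter ms.+1 t = 2%:R * (- s * Liter ms.+1 t) by ring.
by rewrite expRM_natl lerXn2r ?nnegrE ?enorm_ge0 ?expR_ge0.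
Unshelve. all: end_near. Qed.

(** Induction on N with the invariant that the current remainder has an order [theta] satisfying mu
    N < theta + mu 0, as [Rem_step] demands; it starts from y itself with theta = mu 0. *)
Lemma vordgt_Rem N : vordgt ms (mu N) (Rem N.+1).
Proof.
suff [theta th0 [thN hR]] : exists2 theta, mu 0 <= theta &
    mu N < theta + mu 0 /\ vord ms theta (Rem N) by exact: Rem_step hR.
elim: N => [|N [theta th0 [thN hR]]].
  exists (mu 0) => //; split; first by rewrite ltrDl.
  apply: vord_near_eq vord_y; near=> t.
  by rewrite /Rem big_ord0 subr0.
have [sig sN hS] := Rem_step th0 thN hR; exists sig.
  by rewrite (le_trans _ (ltW sN))// mu_le.
split=> //; apply: (@le_lt_trans _ _ (mu N + mu 0)); last by rewrite ltrD2r.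
(* mu N + mu 0 belongs to the range and exceeds mu N, so mu (N + 1) is at most this sum, which is
   below sig + mu 0. *)
have [k _ E] : range mu (mu N + mu 0) by apply: mu_add; [exists N|exists 0%N].
by rewrite -E mu_le -(mu_lt mu_incr) E ltrDl.
Unshelve. all: end_near. Qed.

Lemma solution_expansion :
  asymptotic_expansion ms mu nk y (fun k t => q (Lhat (nk k) t)).
Proof.
split=> [k|N]; first by exists (@q k) => //; exact: q_cl.
have [sig sN hS] := vordgt_Rem N.
(* Order [sig] yields bounds only for exponents below [sig]; the midpoint is still above mu N. *)
have [s1 s2] := midf_lt sN; exists ((mu N + sig) / 2) => //.
exact: vord_bigO hS s2.
Qed.

End Expansion.

Theorem theorem9p3 (R : realType) (n : nat) (n_gt0 : (0 < n)%N)
    (A : 'M[R[i]]_n)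
    (A_eig : forall a : R[i], eigenvalue A a -> 0 < complex.Re a)
    (G : 'cV[R[i]]_n -> 'cV[R[i]]_n)
    (Gm : nat -> 'cV[R[i]]_n -> 'cV[R[i]]_n)
    (GG : forall m : nat, ('I_m -> 'cV[R[i]]_n) -> 'cV[R[i]]_n)
    (G_adm : admissible_nonlinearity G Gm GG)
    (f : R -> 'cV[R[i]]_n) (Tf : R) (Tf_ge0 : 0 <= Tf)
    (f_cont : continuous_within [set t | 0 < t /\ Tf <= t] f)
    (ms : nat) (ms_gt0 : (0 < ms)%N)
    (mu : nat -> R) (mu_gt0 : forall k, 0 < mu k)
    (mu_incr : increasing_seq mu) (mu_div : mu k @[k --> \oo] --> +oo)
    (mu_add : forall x y : R, range mu x -> range mu y -> range mu (x + y))
    (nk : nat -> nat) (nk_ge : forall k, (ms <= nk k)%N)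
    (nk_incr : forall k, (nk k <= nk k.+1)%N)
    (fk : nat -> R -> 'cV[R[i]]_n)
    (f_exp : asymptotic_expansion ms mu nk f fk)
    (T0 : R) (T0_ge0 : 0 <= T0) (y : R -> 'cV[R[i]]_n)
    (y_C1 : C1_above T0 y)
    (y_sol : forall t, T0 < t ->
       has_derivative y t (- (A *m y t) + G (y t) + f t))
    (y_to0 : enorm (y t) @[t --> +oo] --> (0 : R)) :
  (exists yk : nat -> R -> 'cV[R[i]]_n, asymptotic_expansion ms mu nk y yk) /\
  (forall p : forall k, 'rV[R]_(nk k).+2 -> 'cV[R[i]]_n,
     (forall k, classP ms (- mu k) (p k)) ->
     (forall k t, Eiter (nk k) 0 < t -> fk k t = p k (Lhat (nk k) t)) ->
     exists q : forall k, 'rV[R]_(nk k).+2 -> 'cV[R[i]]_n,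
       [/\ forall k, classP ms (- mu k) (q k),
           forall k z, positive_vec z ->
             q k z = opZ A (fun z => nonlinear_sum GG mu q z + p k z) z &
           asymptotic_expansion ms mu nk y (fun k t => q k (Lhat (nk k) t))]).
Proof.
have main (p : forall k, 'rV[R]_(nk k).+2 -> 'cV[R[i]]_n) :
    (forall k, classP ms (- mu k) (p k)) ->
    (forall k t, Eiter (nk k) 0 < t -> fk k t = p k (Lhat (nk k) t)) ->
    exists q : forall k, 'rV[R]_(nk k).+2 -> 'cV[R[i]]_n,
      [/\ forall k, classP ms (- mu k) (q k),
          forall k z, positive_vec z ->
            q k z = opZ A (fun z => nonlinear_sum GG mu q z + p k z) z &
          asymptotic_expansion ms mu nk y (fun k t => q k (Lhat (nk k) t))].
  move=> p_cl fkE.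
  have [q qE] := recursion_solvable A GG mu_gt0 mu_incr p.
  have GG_lin m : (2 <= m)%N -> multilinear_map (GG m).
    by case: G_adm => _ _ _ /(_ m) h /h[].
  exists q; split.
  - exact: (classP_recursion mu_gt0 mu_incr nk_ge nk_incr GG_lin p_cl qE).
  - by move=> k z _; rewrite {1}qE.
  - exact: (solution_expansion n_gt0 A_eig G_adm ms_gt0 mu_gt0 mu_incr mu_add
      nk_ge nk_incr f_exp y_sol y_to0 p_cl fkE qE).
split; last exact: main.
(* For the existence claim, functions [p k] representing the [fk k] are chosen from their classes
   and passed to [main]. *)
have [fk_cl _] := f_exp.
pose p k := s2val (cid2 (fk_cl k)).
have [q [_ _ h]] := main p (fun k => s2valP (cid2 (fk_cl k)))
  (fun k => s2valP' (cid2 (fk_cl k))).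
by exists (fun k t => q k (Lhat (nk k) t)).
Qed.
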